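(* Let $K$ be an arbitrary real valued field (of any characteristic), $0\neq f\in\mathfrak{m}^2\subseteq K\{x\}=K\{x_1,\dots,x_n\}$, and $k\in\mathbb{N}$. 1. If $\mathfrak{m}^{k+2}\subseteq\mathfrak{m}^2\cdot j(f)$, then $f$ is right $(2k-\operatorname{ord}(f)+2)$-determined. 2. If $\mathfrak{m}^{k+2}\subseteq\mathfrak{m}\cdot\langle f\rangle+\mathfrak{m}^2\cdot j(f)$, then $f$ is contact $(2k-\operatorname{ord}(f)+2)$-determined. Moreover, if $0\ne f\in\mathfrak{m}\smallsetminus\mathfrak{m}^2$, then $\operatorname{ord}(f)=1$ and $f$ is right $1$-determined, with $f$ right equivalent to $x_1$.
   Context: A real valued field is a field $K$ with a map $|\ |:K\to\mathbb{R}_{\ge 0}$ satisfying $|a|=0\Leftrightarrow a=0$, $|ab|=|a||b|$, $|a+b|\le|a|+|b|$ (the trivial valuation is allowed; $K$ need not be complete). For $x=(x_1,\dots,x_n)$, $K\{x\}\subseteq K[[x]]$ is the ring of convergent power series: those $f=\sum_\alpha c_\alpha x^\alpha$ for which $\sum_\alpha|c_\alpha|\varepsilon^\alpha<\infty$ for some $\varepsilon\in(\mathbb{R}_{>0})^n$. $\mathfrak{m}=\langle x_1,\dots,x_n\rangle$ is its maximal ideal and $\operatorname{ord}(f)=\max\{l\mid f\in\mathfrak{m}^l\}$ for $f\neq 0$. $\operatorname{Aut}(K\{x\})$ is the group of automorphisms of $K\{x\}$ as a local $K$-algebra. $j(f)=\langle\frac{\partial f}{\partial x_1},\dots,\frac{\partial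 f}{\partial x_n}\rangle$ is the Jacobian ideal. $f,g\in K\{x\}$ are right equivalent if $f=\varphi(g)$ for some $\varphi\in\operatorname{Aut}(K\{x\})$, and contact equivalent if $f=u\cdot\varphi(g)$ for some $\varphi\in\operatorname{Aut}(K\{x\})$ and some unit $u\in K\{x\}^*$. For a positive integer $d$, $f$ is right (resp. contact) $d$-determined if $f$ is right (resp. contact) equivalent to every $g\in K\{x\}$ with $f-g\in\mathfrak{m}^{d+1}$. *)

(* Defs.v *)
From HB Require Import structures.
From mathcomp Require Import all_boot all_order all_algebra finmap.
From mathcomp Require Import all_classical all_reals ereal esum.

Set Implicit Arguments.
Unset Strict Implicit.
Unset Printing Implicit Defensive.

Import Order.TTheory GRing.Theory Num.Theory.

Local Open Scope classical_set_scope.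
Local Open Scope ring_scope.

Record realValuation (R : realType) (K : fieldType) := RealValuation {
  rval :> K -> R;
  rval_ge0 : forall a, 0 <= rval a;
  rval_eq0 : forall a, rval a = 0 <-> a = 0;
  rvalM : forall a b, rval (a * b) = rval a * rval b;
  rvalD : forall a b, rval (a + b) <= rval a + rval b
}.

(* Exponents in N^n, with the pointwise addition of {ffun 'I_n -> nat}. *)
Notation mexp n := {ffun 'I_n -> nat}.

Definition mexp1 (n : nat) (i : 'I_n) : mexp n := [ffun j => (j == i : nat)].

(* K[[x_1, ..., x_n]]: a series is its family of coefficients.  The alias keeps
   the Cauchy product apart from the pointwise product of functions. *)
Definition fpseries (K : fieldType) (n : nat) : Type := mexp n -> K.

Section FormalSeries.
Variables (K : fieldType) (n : nat).
Implicit Types (f g h : fpseries K n) (a : mexp n).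

HB.instance Definition _ := GRing.Zmodule.copy (fpseries K n) (mexp n -> K).

Definition fps_one : fpseries K n := fun a => (a == 0)%:R.

Definition fps_mul f g : fpseries K n :=
  fun a => \sum_(p \in [set p : mexp n * mexp n | p.1 + p.2 = a])
             f p.1 * g p.2.

Definition fps_scale (c : K) f : fpseries K n := fun a => c * f a.

Definition fps_var (i : 'I_n) : fpseries K n := fun a => (a == mexp1 i)%:R.

Definition fps_deriv (i : 'I_n) f : fpseries K n :=
  fun a => f (a + mexp1 i) *+ (a i).+1.

(* Exponents with all entries at most N, as a finite type; proof device only. *)
Definition inbox (N : nat) (b : {ffun 'I_n -> 'I_N.+1}) : mexp n :=
  [ffun i => b i : nat].

Lemma inbox_inj N : injective (@inbox N).
Proof.
move=> b c /ffunP e; apply/ffunP => i; apply/val_inj.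
by have := e i; rewrite !ffunE.
Qed.

Lemma inbox_surj N a : (forall i, (a i <= N)%N) ->
  exists b : {ffun 'I_n -> 'I_N.+1}, inbox b = a.
Proof.
move=> aN; exists [ffun i => inord (a i)].
by apply/ffunP => i; rewrite !ffunE inordK // ltnS.
Qed.

Lemma mexpDE a b i : (a + b : mexp n) i = (a i + b i)%N.
Proof. by rewrite ffunE. Qed.

Lemma fps_mul_box N f g a : (forall i, (a i <= N)%N) ->
  fps_mul f g a = \sum_(b : {ffun 'I_n -> 'I_N.+1})
    \sum_(c : {ffun 'I_n -> 'I_N.+1})
      (if inbox b + inbox c == a then f (inbox b) * g (inbox c) else 0).
Proof.
move=> aN; rewrite /fps_mul.
pose r := [seq (inbox p.1, inbox p.2) |
   p : {ffun 'I_n -> 'I_N.+1} * {ffun 'I_n -> 'I_N.+1}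
   in [pred p | inbox p.1 + inbox p.2 == a]].
have r_uniq : uniq r.
  by rewrite map_inj_uniq ?enum_uniq // =>
    -[b c] [b' c'] /= [/inbox_inj -> /inbox_inj ->].
have rP p : p \in r -> p.1 + p.2 = a.
  by move=> /mapP[q]; rewrite mem_enum inE => /eqP qa ->.
have rS p : p.1 + p.2 = a -> p \notin r -> f p.1 * g p.2 = 0.
  case: p => b c /= bca /negP[].
  have [b' b'E] : exists b' : {ffun 'I_n -> 'I_N.+1}, inbox b' = b.
    apply: inbox_surj => i; apply: leq_trans (aN i).
    by rewrite -bca mexpDE leq_addr.
  have [c' c'E] : exists c' : {ffun 'I_n -> 'I_N.+1}, inbox c' = c.
    apply: inbox_surj => i; apply: leq_trans (aN i).
    by rewrite -bca mexpDE leq_addl.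
  apply/mapP; exists (b', c'); last by rewrite /= b'E c'E.
  by rewrite mem_enum inE /= b'E c'E bca.
rewrite (fsbigE r _ r_uniq) //.
rewrite big_seq_cond [LHS](_ : _ = \sum_(p <- r) f p.1 * g p.2); last first.
  rewrite [RHS]big_seq; apply: eq_bigl => p.
  by rewrite andb_idr // => /rP pa; exact/mem_set.
rewrite big_image /= big_mkcond /= pair_big /=.
by apply: eq_bigr => -[b c].
Qed.

Definition mdeg a : nat := (\sum_i a i)%N.

Lemma mexp_le_deg a i : (a i <= mdeg a)%N.
Proof. by rewrite /mdeg (bigD1 i) //= leq_addr. Qed.

Lemma inbox_le N (b : {ffun 'I_n -> 'I_N.+1}) i : (inbox b i <= N)%N.
Proof. by rewrite ffunE -ltnS. Qed.

Lemma fps_mulC : commutative fps_mul.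
Proof.
move=> f g; apply/funext => a.
rewrite !(@fps_mul_box (mdeg a)); try exact: mexp_le_deg.
rewrite exchange_big /=; apply: eq_bigr => b _; apply: eq_bigr => c _.
by rewrite addrC mulrC.
Qed.

Lemma fps_addE f g a : (f + g) a = f a + g a.
Proof. by []. Qed.

Lemma fps_mulDl : left_distributive fps_mul +%R.
Proof.
move=> f g h; apply/funext => a.
rewrite fps_addE !(@fps_mul_box (mdeg a)); try exact: mexp_le_deg.
rewrite -big_split; apply: eq_bigr => b _ /=.
rewrite -big_split; apply: eq_bigr => c _ /=.
by case: ifP => _; rewrite ?addr0 // -mulrDl.
Qed.

Lemma fps_mul1 : left_id fps_one fps_mul.
Proof.
move=> f; apply/funext => a; pose N := mdeg a.
have aN := mexp_le_deg a.
rewrite (@fps_mul_box N) //.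
have [z zE] : exists z : {ffun 'I_n -> 'I_N.+1}, inbox z = 0.
  by apply: inbox_surj => i; rewrite ffunE.
have [b bE] := inbox_surj aN.
rewrite (bigD1 z) //= [X in _ + X]big1 ?addr0; last first.
  move=> c cz; apply: big1 => d _; rewrite /fps_one.
  case: ifP => // _; rewrite -zE (inj_eq (@inbox_inj N)) (negbTE cz) mul0r //.
rewrite (bigD1 b) //= big1 ?addr0; last first.
  move=> c cb; rewrite zE add0r -bE (inj_eq (@inbox_inj N)) (negbTE cb) //.
by rewrite zE bE add0r eqxx /fps_one eqxx mul1r.
Qed.

Lemma fps_mulA : associative fps_mul.
Proof.
suff tri f g h a : fps_mul f (fps_mul g h) a =
    \sum_(b : {ffun 'I_n -> 'I_(mdeg a).+1})
    \sum_(c : {ffun 'I_n -> 'I_(mdeg a).+1})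
    \sum_(d : {ffun 'I_n -> 'I_(mdeg a).+1})
      (if inbox b + inbox c + inbox d == a
       then f (inbox b) * g (inbox c) * h (inbox d) else 0).
  move=> f g h; rewrite [RHS]fps_mulC; apply/funext => a; rewrite !tri.
  rewrite [RHS]exchange_big; apply: eq_bigr => b _.
  rewrite [RHS]exchange_big; apply: eq_bigr => c _; apply: eq_bigr => d _.
  rewrite /= -[inbox d + _ + _]addrA [inbox d + _]addrC.
  by case: ifP => // _; rewrite -[RHS]mulrA [RHS]mulrC.
have aN := mexp_le_deg a; set N := mdeg a in aN *.
rewrite (@fps_mul_box N) //; apply: eq_bigr => b _.
under eq_bigr => e _ do rewrite (fps_mul_box _ _ (@inbox_le N e)).
transitivity (\sum_(e : {ffun 'I_n -> 'I_N.+1}) \sum_(c : {ffun 'I_n -> 'I_N.+1})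
   \sum_(d : {ffun 'I_n -> 'I_N.+1})
   if (inbox b + inbox e == a) && (inbox c + inbox d == inbox e)
   then f (inbox b) * g (inbox c) * h (inbox d) else 0).
  apply: eq_bigr => e _; case: ifP => _ /=; last first.
    by rewrite big1 // => c _; rewrite big1.
  rewrite big_distrr; apply: eq_bigr => c _; rewrite /= big_distrr.
  by apply: eq_bigr => d _ /=; case: ifP => _; rewrite ?mulr0 ?mulrA.
rewrite exchange_big; apply: eq_bigr => c _.
rewrite exchange_big; apply: eq_bigr => d _ /=.
case: ifPn => [/eqP bcd|bcd]; last first.
  apply: big1 => e _; case: ifP => // /andP[/eqP be /eqP cd].
  by case/eqP: bcd; rewrite -addrA cd.
have [e eE] : exists e : {ffun 'I_n -> 'I_N.+1}, inbox e = inbox c + inbox d.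
  apply: inbox_surj => i; apply: leq_trans (aN i).
  by rewrite -bcd -addrA [leqRHS]mexpDE leq_addl.
rewrite (bigD1 e) //= eE addrA bcd !eqxx /= big1 ?addr0 // => e' e'e.
by rewrite -eE (inj_eq (@inbox_inj N)) [e == _]eq_sym (negbTE e'e) andbF.
Qed.

Lemma fps_one_neq0 : fps_one != 0.
Proof.
apply/eqP => /(congr1 (fun f => f 0)); rewrite /fps_one eqxx.
exact/eqP/oner_neq0.
Qed.

HB.instance Definition _ := GRing.Zmodule_isComNzRing.Build (fpseries K n)
  fps_mulA fps_mulC fps_mul1 fps_mulDl fps_one_neq0.

Lemma fps_scaleA c d f : fps_scale c (fps_scale d f) = fps_scale (c * d) f.
Proof. by apply/funext => a; rewrite /fps_scale mulrA. Qed.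

Lemma fps_scale1 : left_id 1 fps_scale.
Proof. by move=> f; apply/funext => a; rewrite /fps_scale mul1r. Qed.

Lemma fps_scaleDr : right_distributive fps_scale +%R.
Proof. by move=> c f g; apply/funext => a; rewrite /fps_scale mulrDr. Qed.

Lemma fps_scaleDl f : {morph fps_scale^~ f : c d / c + d}.
Proof. by move=> c d; apply/funext => a; rewrite /fps_scale mulrDl. Qed.

HB.instance Definition _ := GRing.Zmodule_isLmodule.Build K (fpseries K n)
  fps_scaleA fps_scale1 fps_scaleDr fps_scaleDl.

Lemma fps_scaleAl (c : K) f g : c *: (f * g) = c *: f * g.
Proof.
apply/funext => a; rewrite /GRing.scale /GRing.mul /= /fps_scale.
rewrite !(@fps_mul_box (mdeg a)); try exact: mexp_le_deg.
rewrite big_distrr; apply: eq_bigr => b _ /=.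
rewrite big_distrr; apply: eq_bigr => d _ /=.
by case: ifP => _; rewrite ?mulr0 ?mulrA.
Qed.

HB.instance Definition _ :=
  GRing.Lmodule_isLalgebra.Build K (fpseries K n) fps_scaleAl.
HB.instance Definition _ := GRing.Lalgebra_isComAlgebra.Build K (fpseries K n).

End FormalSeries.

Section ConvergentSeries.
Variables (R : realType) (K : fieldType) (v : realValuation R K) (n : nat).
Implicit Types (f g : fpseries K n) (a : mexp n).

Definition convergent f : Prop :=
  exists eps : 'I_n -> R, (forall i, 0 < eps i) /\
    (\esum_(a in [set: mexp n]) (v (f a) * \prod_i eps i ^+ a i)%:E < +oo)%E.

Lemma rval0 : v 0 = 0.
Proof. exact/rval_eq0. Qed.

Lemma rval1 : v 1 = 1.
Proof.
have v1 : v 1 != 0 by apply/eqP => /rval_eq0/eqP; rewrite oner_eq0.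
by apply: (mulfI v1); rewrite mulr1 -rvalM mulr1.
Qed.

Lemma rvalN c : v (- c) = v c.
Proof.
rewrite -mulN1r rvalM; suff -> : v (- 1) = 1 by rewrite mul1r.
apply/eqP; rewrite -(@eqrXn2 _ 2) ?rval_ge0 // expr1n expr2 -rvalM.
by rewrite mulrNN mulr1 rval1.
Qed.

Lemma rval_sum (I : Type) (s : seq I) (P : pred I) (F : I -> K) :
  v (\sum_(i <- s | P i) F i) <= \sum_(i <- s | P i) v (F i).
Proof.
elim/big_ind2 : _ => [|x1 x2 y1 y2 h1 h2|//]; first by rewrite rval0.
exact: le_trans (rvalD _ _ _) (lerD h1 h2).
Qed.

Lemma rval_mulrn c k : v (c *+ k) <= v c *+ k.
Proof.
elim: k => [|k IH]; first by rewrite !mulr0n rval0.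
by rewrite !mulrS (le_trans (rvalD _ _ _)) // lerD2l.
Qed.

Lemma sum_uniq_box (F : mexp n -> R) (s : seq (mexp n)) N :
  (forall a, 0 <= F a) -> uniq s -> (forall a i, a \in s -> (a i <= N)%N) ->
  \sum_(a <- s) F a <= \sum_(b : {ffun 'I_n -> 'I_N.+1}) F (inbox b).
Proof.
move=> F0 s_uniq sN.
have bs (b : {ffun 'I_n -> 'I_N.+1}) :
    \sum_(a <- s) (if inbox b == a then F a else 0) <= F (inbox b).
  have [bs|bs] := boolP (inbox b \in s).
    rewrite (bigD1_seq (inbox b)) //= eqxx big1 ?addr0 // => a /negbTE ab.
    by rewrite eq_sym ab.
  rewrite -big_mkcond big_seq_cond big1 // => a /andP[as_ /eqP ba].
  by rewrite ba as_ in bs.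
apply: le_trans (ler_sum _ (fun b _ => bs b)); rewrite exchange_big /=.
rewrite big_seq [leRHS]big_seq; apply: ler_sum => a as_.
have [b <-] := @inbox_surj n N a (fun i => sN a i as_).
rewrite (bigD1 b) //= eqxx lerDl; apply: sumr_ge0 => c _.
by case: ifP.
Qed.

Lemma convergentP f : convergent f <-> exists r M : R, 0 < r /\
  forall N, \sum_(b : {ffun 'I_n -> 'I_N.+1})
    v (f (inbox b)) * r ^+ mdeg (inbox b) <= M.
Proof.
split=> [[eps [eps0]]|[r [M [r0 rM]]]]; last first.
  exists (fun=> r); split => //; apply: (@le_lt_trans _ _ M%:E); last first.
    exact: ltry.
  apply: ge_ereal_sup => _ [A [Afin _] <-].
  rewrite fsbig_finite // sumEFin lee_fin.
  pose N := (\max_(a <- fset_set A) mdeg a)%N.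
  apply: le_trans (rM N).
  have -> : \sum_(a <- fset_set A) v (f a) * \prod_(i < n) r ^+ a i =
    \sum_(a <- fset_set A) v (f a) * r ^+ mdeg a.
    by apply: eq_bigr => a _; rewrite prodrXr.
  apply: (@sum_uniq_box (fun a => v (f a) * r ^+ mdeg a)) => //.
  - by move=> a; rewrite mulr_ge0 ?rval_ge0 // exprn_ge0 // ltW.
  - exact: fset_uniq.
  - move=> a i aA; apply: leq_trans (mexp_le_deg a i) _.
    exact: leq_bigmax_seq.
set S := esum _ _ => Sfin.
pose r := \big[Order.min/1]_i eps i.
have r0 : 0 < r by rewrite lt_bigmin.
have rle i : r <= eps i by exact: bigmin_le.
have F0 a : 0 <= v (f a) * \prod_i eps i ^+ a i.
  by rewrite mulr_ge0 ?rval_ge0 // prodr_ge0 // => i _; rewrite exprn_ge0 // ltW.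
have S0 : (0 <= S)%E by apply: esum_ge0 => a _; rewrite lee_fin.
exists r, (fine S); split=> // N.
rewrite -lee_fin fineK ?ge0_fin_numE //.
apply: esum_ge; exists [set` [seq inbox b | b : {ffun 'I_n -> 'I_N.+1}]].
  by split=> //; exact: finite_seq.
rewrite -fsbig_seq; last first.
  by rewrite map_inj_uniq -?enumT ?enum_uniq //; exact: inbox_inj.
rewrite big_image /= sumEFin lee_fin; apply: ler_sum => b _.
rewrite ler_wpM2l ?rval_ge0 // /mdeg -prodrXr.
by apply: ler_prod => i _; rewrite exprn_ge0 ?(ltW r0) //= lerXn2r // nnegrE ltW.
Qed.

Lemma convergent_mono a : convergent (fun b => (b == a)%:R).
Proof.
apply/convergentP; exists 1, 1; split=> // N.
have [[b ba]|nba] := pselect (exists b : {ffun 'I_n -> 'I_N.+1}, inbox b = a).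
  rewrite (bigD1 b) //= ba eqxx rval1 expr1n mulr1 big1 ?addr0 // => c cb.
  by rewrite -ba (inj_eq (@inbox_inj n N)) (negbTE cb) rval0 mul0r.
rewrite big1 // => b _; have [ba|] := eqVneq (inbox b) a.
  by case: nba; exists b.
by rewrite rval0 mul0r.
Qed.

Lemma convergent0 : convergent (0 : fpseries K n).
Proof.
apply/convergentP; exists 1, 0; split=> // N.
by rewrite big1 // => b _; rewrite [X in v X](_ : _ = 0) // rval0 mul0r.
Qed.

Lemma convergentP2 f g : convergent f -> convergent g ->
  exists r Mf Mg : R, 0 < r /\
  forall N, \sum_(b : {ffun 'I_n -> 'I_N.+1})
      v (f (inbox b)) * r ^+ mdeg (inbox b) <= Mf /\
    \sum_(b : {ffun 'I_n -> 'I_N.+1})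
      v (g (inbox b)) * r ^+ mdeg (inbox b) <= Mg.
Proof.
move=> /convergentP[r [Mf [r0 rM]]] /convergentP[s [Mg [s0 sM]]].
have t0 : 0 < Order.min r s by rewrite lt_min r0.
exists (Order.min r s), Mf, Mg; split=> // N; split.
  apply: le_trans (rM N); apply: ler_sum => b _.
  rewrite ler_wpM2l ?rval_ge0 // lerXn2r ?nnegrE ?(ltW t0) ?(ltW r0) //.
  by rewrite ge_min lexx.
apply: le_trans (sM N); apply: ler_sum => b _.
rewrite ler_wpM2l ?rval_ge0 // lerXn2r ?nnegrE ?(ltW t0) ?(ltW s0) //.
by rewrite ge_min lexx orbT.
Qed.

Lemma convergentD f g : convergent f -> convergent g -> convergent (f + g).
Proof.
move=> cf cg; have [r [Mf [Mg [r0 rM]]]] := convergentP2 cf cg.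
apply/convergentP; exists r, (Mf + Mg); split=> // N.
have [fM gM] := rM N; apply: le_trans (lerD fM gM).
rewrite -big_split; apply: ler_sum => b _ /=.
by rewrite -mulrDl ler_wpM2r ?rvalD // exprn_ge0 // ltW.
Qed.

Lemma convergentZ c f : convergent f -> convergent (c *: f).
Proof.
move=> /convergentP[r [M [r0 rM]]].
apply/convergentP; exists r, (v c * M); split=> // N.
apply: le_trans (ler_wpM2l (rval_ge0 v c) (rM N)); rewrite big_distrr.
by apply: ler_sum => b _ /=; rewrite mulrA -rvalM.
Qed.

Lemma mdegD a b : mdeg (a + b) = (mdeg a + mdeg b)%N.
Proof. by rewrite /mdeg -big_split; apply: eq_bigr => i _; rewrite mexpDE. Qed.

Lemma convergentM f g : convergent f -> convergent g -> convergent (f * g).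
Proof.
move=> cf cg; have [r [Mf [Mg [r0 rM]]]] := convergentP2 cf cg.
have r0' k : 0 <= r ^+ k by rewrite exprn_ge0 // ltW.
apply/convergentP; exists r, (Mf * Mg); split=> // N.
have [fM gM] := rM N.
pose F b := v (f b) * r ^+ mdeg b; pose G b := v (g b) * r ^+ mdeg b.
have F0 b : 0 <= F b by rewrite mulr_ge0 ?rval_ge0.
have G0 b : 0 <= G b by rewrite mulr_ge0 ?rval_ge0.
apply: (@le_trans _ _ (\sum_(b : {ffun 'I_n -> 'I_N.+1})
   \sum_(c : {ffun 'I_n -> 'I_N.+1}) F (inbox b) * G (inbox c))); last first.
  rewrite (_ : \sum_b _ = (\sum_(b : {ffun 'I_n -> 'I_N.+1}) F (inbox b)) *
     (\sum_(b : {ffun 'I_n -> 'I_N.+1}) G (inbox b))); last first.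
    by rewrite big_distrl; apply: eq_bigr => b _ /=; rewrite big_distrr.
  by apply: ler_pM => //; apply: sumr_ge0.
apply: (@le_trans _ _ (\sum_(a : {ffun 'I_n -> 'I_N.+1})
   \sum_(b : {ffun 'I_n -> 'I_N.+1}) \sum_(c : {ffun 'I_n -> 'I_N.+1})
   if inbox b + inbox c == inbox a then F (inbox b) * G (inbox c) else 0)).
  apply: ler_sum => a _.
  rewrite /GRing.mul /= (fps_mul_box _ _ (@inbox_le n N a)).
  apply: le_trans (ler_wpM2r (r0' _) (rval_sum _ _ _)) _.
  rewrite big_distrl; apply: ler_sum => b _ /=.
  apply: le_trans (ler_wpM2r (r0' _) (rval_sum _ _ _)) _.
  rewrite big_distrl; apply: ler_sum => c _ /=.
  case: ifP => [/eqP <-|_]; last by rewrite rval0 mul0r.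
  by rewrite rvalM mdegD exprD mulrACA.
rewrite exchange_big; apply: ler_sum => b _ /=.
rewrite exchange_big; apply: ler_sum => c _ /=.
rewrite -big_mkcond.
have [[a abc]|na] := pselect
    (exists a : {ffun 'I_n -> 'I_N.+1}, inbox b + inbox c = inbox a).
  rewrite (big_pred1 a) // => a' /=; rewrite abc (inj_eq (@inbox_inj n N)).
  by rewrite eq_sym.
rewrite big_pred0 => [|a]; first exact: mulr_ge0.
apply/negbTE/negP => /eqP abc.
by apply: na; exists a.
Qed.

Lemma mdeg_mexp1 (i : 'I_n) : mdeg (mexp1 i) = 1%N.
Proof.
rewrite /mdeg (bigD1 i) //= ffunE eqxx big1 // => j /negbTE ji.
by rewrite ffunE ji.
Qed.

Lemma convergent_deriv i f : convergent f -> convergent (fps_deriv i f).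
Proof.
move=> /convergentP[r [M [r0 rM]]].
apply/convergentP; exists (r / 2), (r^-1 * M); split=> [|N].
  by rewrite divr_gt0.
pose F a := v (f a) * r ^+ mdeg a.
have F0 a : 0 <= F a by rewrite mulr_ge0 ?rval_ge0 // exprn_ge0 // ltW.
apply: (@le_trans _ _ (r^-1 * \sum_(b : {ffun 'I_n -> 'I_N.+1})
   F (inbox b + mexp1 i))); last first.
  rewrite ler_wpM2l ?invr_ge0 ?(ltW r0) //.
  apply: le_trans (rM N.+1).
  pose s := [seq inbox b + mexp1 i | b : {ffun 'I_n -> 'I_N.+1}].
  rewrite [leLHS](_ : _ = \sum_(a <- s) F a); last by rewrite big_image.
  apply: sum_uniq_box => //.
    rewrite map_inj_uniq -?enumT ?enum_uniq // => b c e.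
    apply: (@inbox_inj n N); apply/ffunP => j.
    by move/ffunP/(_ j): e; rewrite !mexpDE => /addIn.
  move=> a j /mapP[b _ ->]; rewrite mexpDE [mexp1 i j]ffunE.
  apply: (@leq_trans (N + 1)%N); last by rewrite addn1.
  apply: leq_add; first exact: inbox_le.
  by case: (_ == _).
rewrite big_distrr; apply: ler_sum => b _ /=; rewrite /fps_deriv /F mdegD.
rewrite mdeg_mexp1 addn1 exprSr.
have -> : r^-1 * (v (f (inbox b + mexp1 i)) * (r ^+ mdeg (inbox b) * r)) =
   v (f (inbox b + mexp1 i)) * r ^+ mdeg (inbox b).
  by rewrite mulrC -!mulrA divff ?gt_eqF // mulr1.
apply: (@le_trans _ _ (v (f (inbox b + mexp1 i)) *+ (inbox b i).+1 *
    (r / 2) ^+ mdeg (inbox b))).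
  by rewrite ler_wpM2r ?rval_mulrn // exprn_ge0 // divr_ge0 // ltW.
rewrite mulrnAl -mulrnAr ler_wpM2l ?rval_ge0 // expr_div_n -mulrnAr ler_piMr //.
  by rewrite exprn_ge0 // ltW.
rewrite -[_ *+ _]mulr_natl ler_pdivrMr ?exprn_gt0 // mul1r -natrX ler_nat.
apply: leq_trans (ltn_expl _ (isT : 1 < 2)%N) _.
by rewrite leq_exp2l // mexp_le_deg.
Qed.

Definition fps_conv : {pred fpseries K n} := fun f => `[< convergent f >].

Fact fps_conv_subalg : GRing.subalg_closed fps_conv.
Proof.
split=> [|c f g /asboolP cf /asboolP cg|f g /asboolP cf /asboolP cg].
- exact/asboolP/(convergent_mono 0).
- exact/asboolP/convergentD/cg/convergentZ.
- exact/asboolP/convergentM.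
Qed.

HB.instance Definition _ :=
  GRing.isSubalgClosed.Build K (fpseries K n) fps_conv fps_conv_subalg.

(* K{x_1, ..., x_n}, as a subalgebra of K[[x_1, ..., x_n]]. *)
Record cpseries := CPSeries {
  cps_val :> fpseries K n;
  _ : cps_val \in fps_conv
}.

HB.instance Definition _ := [isSub for cps_val].
HB.instance Definition _ := [Choice of cpseries by <:].
HB.instance Definition _ :=
  [SubChoice_isSubComNzRing of cpseries by <:].
HB.instance Definition _ := [SubZmodule_isSubLmodule of cpseries by <:].
HB.instance Definition _ :=
  [SubNzRing_SubLmodule_isSubLalgebra of cpseries by <:].
HB.instance Definition _ := [SubLalgebra_isSubAlgebra of cpseries by <:].

Definition cps_unit : {pred cpseries} := fun u => `[< exists w, w * u = 1 >].

Definition cps_inv (u : cpseries) : cpseries := xget u [set w | w * u = 1].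

Fact cps_mulVx : {in cps_unit, left_inverse 1 cps_inv *%R}.
Proof.
move=> u /asboolP[w wu]; rewrite /cps_inv.
by case: xgetP => [//|/(_ w) []].
Qed.

Fact cps_unitPl (u w : cpseries) : w * u = 1 -> cps_unit u.
Proof. by move=> wu; apply/asboolP; exists w. Qed.

Fact cps_inv_out : {in [predC cps_unit], cps_inv =1 id}.
Proof.
move=> u; rewrite inE => /asboolP nu; rewrite /cps_inv.
by case: xgetP => // w _ wu; case: nu; exists w.
Qed.

HB.instance Definition _ := GRing.ComNzRing_hasMulInverse.Build cpseries
  cps_mulVx cps_unitPl cps_inv_out.

Definition cps_var (i : 'I_n) : cpseries :=
  CPSeries (asboolT (convergent_mono (mexp1 i)) : fps_var K i \in fps_conv).

Fact cps_deriv_subproof (i : 'I_n) (f : cpseries) :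
  fps_deriv i f \in fps_conv.
Proof. by apply/asboolP/convergent_deriv/asboolP; case: f. Qed.

Definition cps_deriv (i : 'I_n) (f : cpseries) : cpseries :=
  CPSeries (cps_deriv_subproof i f).

End ConvergentSeries.

Section Ideals.
Variable A : comNzRingType.
Implicit Types (S I J : set A).

Definition ideal_span S : set A :=
  [set x | exists s : seq (A * A), (forall p, p \in s -> S p.2) /\
                                   x = \sum_(p <- s) p.1 * p.2].

Definition ideal_add I J : set A := [set x + y | x in I & y in J].

Definition ideal_mul I J : set A := ideal_span [set x * y | x in I & y in J].

Definition ideal_exp I (l : nat) : set A := iter l (ideal_mul I) setT.

End Ideals.

Section Determinacy.
Variables (R : realType) (K : fieldType) (v : realValuation R K) (n : nat).
Local Notation A := (cpseries v n).
Implicit Types (f g : A).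

Definition maxideal : set A := ideal_span (range (@cps_var R K v n)).

Definition jacobian f : set A := ideal_span (range (fun i => cps_deriv i f)).

(* max {l | f in m^l}; the default 0 is only used for f = 0, where there is no
   maximum. *)
Definition ord f : nat :=
  xget 0%N [set l | ideal_exp maxideal l f /\
                    forall l', ideal_exp maxideal l' f -> (l' <= l)%N].

Definition local_aut (phi : {lrmorphism A -> A}) : Prop :=
  bijective phi /\ phi @` maxideal `<=` maxideal.

Definition right_equiv f g : Prop :=
  exists2 phi : {lrmorphism A -> A}, local_aut phi & f = phi g.

Definition contact_equiv f g : Prop :=
  exists2 phi : {lrmorphism A -> A}, local_aut phi &
  exists2 u : A, u \is a GRing.unit & f = u * phi g.

Definition right_determined (d : nat) f : Prop :=
  forall g, ideal_exp maxideal d.+1 (f - g) -> right_equiv f g.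

Definition contact_determined (d : nat) f : Prop :=
  forall g, ideal_exp maxideal d.+1 (f - g) -> contact_equiv f g.

End Determinacy.

Arguments maxideal {R K} v n _.

(* Main.v *)
Require Import Defs.
From HB Require Import structures.
From mathcomp Require Import all_boot all_order all_algebra.
From mathcomp Require Import all_classical all_reals.
From mathcomp Require Import perm.
From mathcomp Require Import ring lra zify.

Set Implicit Arguments.
Unset Strict Implicit.
Unset Printing Implicit Defensive.

Import Order.TTheory GRing.Theory Num.Theory.

Local Open Scope classical_set_scope.
Local Open Scope ring_scope.

(** Let $o = \mathrm{ord}(f)$, $e = k + 1 - o$ and
    $N = 2k + 3 - o = k + 2 + e$, so that determinacy is about perturbations
    $G \in \mathfrak m^N$ of $f$.  Multiplying the hypothesis by
    $\mathfrak m^e$ writes every monomial of degree $N$, hence (linearly and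
    continuously) every $F \in \mathfrak m^N$, as
    $F = Z f + \sum_i Y_i \partial_i f$ with $Z \in \mathfrak m^{1 + e}$ and
    $Y_i \in \mathfrak m^{2 + e}$; for right equivalence $Z = 0$.  If
    $\rho_Y(f) = f(x + Y) - f - \sum_i Y_i \partial_i f$ is the remainder of the
    Taylor expansion, the equation $(1 + Z) f(x + Y) = f + G$ becomes
    $$F = G - \rho_Y(f) - Z \Bigl(\sum_i Y_i \partial_i f + \rho_Y(f)\Bigr).$$
    The nonlinear terms are at least quadratic in $(Z, Y)$ and lie in
    $\mathfrak m^{o - 2 + 2 (2 + e)} = \mathfrak m^{N + 1}$, so the right-hand
    side is a contraction for the $x$-adic topology and has a unique formal
    fixed point $F$.  No characteristic enters, since $\rho$ is handled without
    higher derivatives.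

    Convergence is obtained without completeness of $K$.  With the weighted norm
    $\|h\|_r = \sum_a |h_a| r^{|a|}$, the same order count shows that, for small
    $r$, the right-hand side maps a ball of radius $M r^N$ into itself: the
    nonlinear terms are $O(r^{N + 1})$.  Such balls are closed for the $x$-adic
    topology, so the formal limit of the iterates of 0 lies in the ball
    ([adic_fixpoint]).  The same lemma gives the inverse function theorem for
    maps tangent to the identity ([tangent_inverse]) and the inverse of $1 + Z$
    ([unit_inverse]), which turn the solution $(Z, Y)$
    ([perturbed_equation_solvable]) into an equivalence
    ([perturbation_equiv]).

    When $f$ has order one, a linear change of coordinates followed by one that
    is tangent to the identity makes $f$ the first coordinate
    ([regular_coordinate]); any $g$ with the same linear part can be treated in
    the same way, hence is equivalent to $f$.

    All estimates, on orders and on norms, concern continuous linear maps and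
    are checked on monomials only ([clin_ord], [clin_norm]). *)

(** * Orders, continuous linear maps and substitution *)

Section Orders.
Variables (K : fieldType) (n : nat).
Implicit Types (f g h : fpseries K n) (a b c : mexp n).

Definition mono a : fpseries K n := fun b => (b == a)%:R.

Definition ordge (s : nat) f : Prop := forall a, (mdeg a < s)%N -> f a = 0.

Lemma fps_oppE f a : (- f) a = - f a.
Proof. by []. Qed.

Lemma fps_subE f g a : (f - g) a = f a - g a.
Proof. by []. Qed.

Lemma fps_scaleE (k : K) f a : (k *: f) a = k * f a.
Proof. by []. Qed.

Lemma fps_sumE (I : Type) (s : seq I) (P : pred I) (F : I -> fpseries K n) a :
  (\sum_(i <- s | P i) F i) a = \sum_(i <- s | P i) F i a.
Proof. by elim/big_rec2: _ => // i x y _ <-. Qed.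

Lemma mul_ffE f g a : (f * g) a =
  \sum_(b : {ffun 'I_n -> 'I_(mdeg a).+1})
    \sum_(c : {ffun 'I_n -> 'I_(mdeg a).+1})
      (if inbox b + inbox c == a then f (inbox b) * g (inbox c) else 0).
Proof. exact: (fps_mul_box f g (@mexp_le_deg n a)). Qed.

Lemma mexp_addI a b c : a + b = a + c -> b = c.
Proof.
by move=> /ffunP e; apply/ffunP => i; have := e i; rewrite !mexpDE => /addnI.
Qed.

Lemma mdeg0 : mdeg (0 : mexp n) = 0%N.
Proof. by rewrite /mdeg big1 // => i _; rewrite ffunE. Qed.

Lemma mdeg_eq0 a : mdeg a = 0%N -> a = 0.
Proof.
move=> a0; apply/ffunP => i; rewrite ffunE; apply/eqP.
by rewrite -leqn0 -a0 mexp_le_deg.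
Qed.

Lemma mono_mulD c g b : (mono c * g) (c + b) = g b.
Proof.
rewrite mul_ffE.
have le_c i : (c i <= mdeg (c + b)%R)%N.
  by apply: leq_trans (mexp_le_deg _ i); rewrite mexpDE leq_addr.
have le_b i : (b i <= mdeg (c + b)%R)%N.
  by apply: leq_trans (mexp_le_deg _ i); rewrite mexpDE leq_addl.
have [c' cE] := inbox_surj le_c; have [b' bE] := inbox_surj le_b.
rewrite (bigD1 c') //= [X in _ + X]big1 ?addr0 => [|d dc]; last first.
  apply: big1 => e _; have : inbox d != c.
    by apply: contra_neq dc => dE; apply: (@inbox_inj n); rewrite dE.
  by rewrite /mono => /negbTE ->; rewrite mul0r; case: ifP.
rewrite (bigD1 b') //= big1 ?addr0 => [|d db]; last first.
  case: eqP => //; rewrite cE => /mexp_addI dE.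
  by case/eqP: db; apply: (@inbox_inj n); rewrite dE.
by rewrite cE bE eqxx /mono eqxx mul1r.
Qed.

Lemma mono_mul_out c g a : (forall b, a <> c + b) -> (mono c * g) a = 0.
Proof.
move=> ac; rewrite mul_ffE big1 // => b _; rewrite big1 // => d _.
case: eqP => // bd; rewrite /mono; case: eqP => [bc|]; last by rewrite mul0r.
by case: (ac (inbox d)); rewrite -bc; exact/esym.
Qed.

Lemma monoM a b : mono a * mono b = mono (a + b).
Proof.
apply/funext => c; have [[d ->]|nd] := pselect (exists d, c = a + d).
  rewrite mono_mulD /mono; congr ((nat_of_bool _)%:R); apply/eqP/eqP => [->//|].
  exact: mexp_addI.
rewrite mono_mul_out => [|d cd]; last by apply: nd; exists d.
by rewrite /mono; case: eqP => // cE; case: nd; exists b.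
Qed.

Lemma mono0 : mono 0 = 1.
Proof. by []. Qed.

Lemma mono1E i : mono (mexp1 i) = fps_var K i.
Proof. by []. Qed.

(** Induction that multiplies a monomial by one variable at a time; the
    estimates below follow recursions of this shape. *)
Lemma mexp_ind (P : mexp n -> Prop) :
  P 0 -> (forall a i, P a -> P (a + mexp1 i)) -> forall a, P a.
Proof.
move=> P0 PS a; move: {2}(mdeg a) (erefl (mdeg a)) => d.
elim: d a => [|d IH] a da; first by rewrite (mdeg_eq0 da).
have [i ai] : exists i, (0 < a i)%N.
  apply: contrapT => na; suff: mdeg a = 0%N by rewrite da.
  rewrite /mdeg big1 // => i _; apply/eqP; rewrite -leqn0 leqNgt.
  by apply/negP => ai; apply: na; exists i.
pose b : mexp n := [ffun j => (a j - (j == i))%N].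
have ab : a = b + mexp1 i.
  apply/ffunP => j; rewrite mexpDE !ffunE subnK //.
  by case: eqP => // ->.
by rewrite ab; apply: PS; apply: IH; move: da; rewrite ab mdegD mdeg_mexp1; lia.
Qed.

Lemma ordgeW s t f : (s <= t)%N -> ordge t f -> ordge s f.
Proof. by move=> st tf a ha; apply/tf/(leq_trans ha). Qed.

Lemma ordge0 f : ordge 0 f.
Proof. by []. Qed.

Lemma ordge_zero s : ordge s 0.
Proof. by []. Qed.

Lemma ordgeD s f g : ordge s f -> ordge s g -> ordge s (f + g).
Proof. by move=> sf sg a ha; rewrite fps_addE sf // sg // addr0. Qed.

Lemma ordgeN s f : ordge s f -> ordge s (- f).
Proof. by move=> sf a ha; rewrite fps_oppE sf // oppr0. Qed.

Lemma ordgeB s f g : ordge s f -> ordge s g -> ordge s (f - g).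
Proof. by move=> sf sg; apply/ordgeD/ordgeN. Qed.

Lemma ordgeZ s (k : K) f : ordge s f -> ordge s (k *: f).
Proof. by move=> sf a ha; rewrite fps_scaleE sf // mulr0. Qed.

Lemma ordge_sum s (I : Type) (r : seq I) (P : pred I) (F : I -> fpseries K n) :
  (forall i, P i -> ordge s (F i)) -> ordge s (\sum_(i <- r | P i) F i).
Proof.
by move=> sF; elim/big_ind: _ => // f g; exact: ordgeD.
Qed.

Lemma ordgeM s t f g : ordge s f -> ordge t g -> ordge (s + t) (f * g).
Proof.
move=> sf tg a ha; rewrite mul_ffE big1 // => b _; rewrite big1 // => c _.
case: eqP => // /(congr1 (@mdeg n)); rewrite mdegD => bc.
have [bs|sb] := ltnP (mdeg (inbox b)) s; first by rewrite sf // mul0r.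
by rewrite tg ?mulr0 //; move: ha bc sb; lia.
Qed.

Lemma ordgeMW s t u f g : (u <= s + t)%N ->
  ordge s f -> ordge t g -> ordge u (f * g).
Proof. by move=> ust sf tg; apply/(ordgeW ust)/ordgeM. Qed.

Lemma ordge_mono a : ordge (mdeg a) (mono a).
Proof. by move=> b; rewrite /mono; case: eqP => // ->; rewrite ltnn. Qed.

Lemma ordge_deriv s i f : ordge s.+1 f -> ordge s (fps_deriv i f).
Proof.
by move=> sf a ha; rewrite /fps_deriv sf ?mul0rn // mdegD mdeg_mexp1 addn1.
Qed.

Lemma ordge_eq0 f : (forall s, ordge s f) -> f = 0.
Proof. by move=> sf; apply/funext => a; apply: (sf (mdeg a).+1). Qed.

Definition fps_trunc D f : fpseries K n :=
  \sum_(b : {ffun 'I_n -> 'I_D.+1}) f (inbox b) *: mono (inbox b).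

Lemma fps_truncP D f : ordge D.+1 (f - fps_trunc D f).
Proof.
move=> a aD; rewrite fps_subE /fps_trunc fps_sumE.
have [b bE] : exists b : {ffun 'I_n -> 'I_D.+1}, inbox b = a.
  by apply: inbox_surj => i; apply: leq_trans (mexp_le_deg a i) _.
rewrite (bigD1 b) //= big1 ?addr0 => [|c cb]; rewrite fps_scaleE /mono.
  by rewrite bE eqxx mulr1 subrr.
by rewrite -bE (inj_eq (@inbox_inj n _)) eq_sym (negbTE cb) mulr0.
Qed.

(** Continuity is for the $x$-adic topology, and a loss of orders is allowed, as
    for derivations. *)
Definition clin (Phi : fpseries K n -> fpseries K n) : Prop :=
  (forall (k : K) f g, Phi (k *: f + g) = k *: Phi f + Phi g) /\
  (forall q, exists s, forall f, ordge s f -> ordge q (Phi f)).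

Section ClinTheory.
Variable Phi : fpseries K n -> fpseries K n.
Hypothesis PhiP : clin Phi.

Lemma clin0 : Phi 0 = 0.
Proof.
have := PhiP.1 1 0 0; rewrite !scale1r addr0 => /eqP.
by rewrite -[X in X == _]addr0 (inj_eq (addrI _)) eq_sym => /eqP.
Qed.

Lemma clinZ (k : K) f : Phi (k *: f) = k *: Phi f.
Proof. by rewrite -[k *: f]addr0 PhiP.1 clin0 addr0. Qed.

Lemma clinD f g : Phi (f + g) = Phi f + Phi g.
Proof. by rewrite -[f]scale1r PhiP.1 !scale1r. Qed.

Lemma clinB f g : Phi (f - g) = Phi f - Phi g.
Proof. by rewrite clinD -scaleN1r clinZ scaleN1r. Qed.

Lemma clin_sum (I : Type) (r : seq I) (P : pred I) (F : I -> fpseries K n) :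
  Phi (\sum_(i <- r | P i) F i) = \sum_(i <- r | P i) Phi (F i).
Proof. exact: (big_morph Phi clinD clin0). Qed.

(** Truncations of [f] converge $x$-adically to [f]: modulo a power of the
    maximal ideal, a continuous linear map is a finite combination of its values
    on monomials. *)
Lemma clin_trunc q f : exists D0, forall D, (D0 <= D)%N ->
  ordge q (Phi f - \sum_(b : {ffun 'I_n -> 'I_D.+1})
                      f (inbox b) *: Phi (mono (inbox b))).
Proof.
have [D0 D0P] := PhiP.2 q; exists D0 => D D0D.
have -> : \sum_(b : {ffun 'I_n -> 'I_D.+1})
    f (inbox b) *: Phi (mono (inbox b)) = Phi (fps_trunc D f).
  by rewrite clin_sum; apply: eq_bigr => b _; rewrite clinZ.
by rewrite -clinB; apply/D0P/(ordgeW _ (@fps_truncP D f))/leqW.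
Qed.

Lemma clin_ord s q f : (forall a, (s <= mdeg a)%N -> ordge q (Phi (mono a))) ->
  ordge s f -> ordge q (Phi f).
Proof.
move=> monoq sf; have [D /(_ D (leqnn D)) Dq] := clin_trunc q f.
rewrite -[Phi f](subrK (\sum_(b : {ffun 'I_n -> 'I_D.+1})
    f (inbox b) *: Phi (mono (inbox b)))).
apply: ordgeD => //; apply: ordge_sum => b _.
have [bs|sb] := ltnP (mdeg (inbox b)) s; last exact/ordgeZ/monoq.
by rewrite sf // scale0r; exact: ordge_zero.
Qed.

(** The $x$-adic topology is separated. *)
Lemma clin_eq0 s f : (forall a, (s <= mdeg a)%N -> Phi (mono a) = 0) ->
  ordge s f -> Phi f = 0.
Proof.
move=> mono_eq sf; apply: ordge_eq0 => q; apply: clin_ord sf => a sa.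
by rewrite mono_eq //; exact: ordge_zero.
Qed.

End ClinTheory.

Lemma clin_id : clin id.
Proof. by split=> // q; exists q. Qed.

Lemma clin_comb Phi Psi : clin Phi -> clin Psi ->
  clin (fun f => Phi f + Psi f).
Proof.
move=> [PhiL PhiC] [PsiL PsiC]; split=> [k f g|q].
  by rewrite PhiL PsiL scalerDr addrACA.
have [s sP] := PhiC q; have [t tP] := PsiC q; exists (maxn s t) => f fP.
by apply: ordgeD; [apply: sP|apply: tP]; apply: ordgeW fP;
  rewrite ?leq_maxl ?leq_maxr.
Qed.

Lemma clin_opp Phi : clin Phi -> clin (fun f => - Phi f).
Proof.
move=> [PhiL PhiC]; split=> [k f g|q]; first by rewrite PhiL opprD scalerN.
by have [s sP] := PhiC q; exists s => f /sP; exact: ordgeN.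
Qed.

Lemma clin_diff Phi Psi : clin Phi -> clin Psi ->
  clin (fun f => Phi f - Psi f).
Proof. by move=> ? ?; apply/clin_comb/clin_opp. Qed.

Lemma clin_comp Phi Psi : clin Phi -> clin Psi -> clin (Phi \o Psi).
Proof.
move=> [PhiL PhiC] [PsiL PsiC]; split=> [k f g|q] /=.
  by rewrite PsiL PhiL.
have [s sP] := PhiC q; have [t tP] := PsiC s.
by exists t => f /tP /sP.
Qed.

Lemma clin_mulr g : clin (fun f => f * g).
Proof.
split=> [k f h|q]; first by rewrite mulrDl scalerAl.
by exists q => f fq; rewrite -[q]addn0; apply: ordgeM.
Qed.

Lemma clin_mul Phi g : clin Phi -> clin (fun f => Phi f * g).
Proof. exact: (clin_comp (clin_mulr g)). Qed.

Lemma clin_bigsum (I : Type) (r : seq I)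
    (Phi : I -> fpseries K n -> fpseries K n) :
  (forall i, clin (Phi i)) -> clin (fun f => \sum_(i <- r) Phi i f).
Proof.
move=> PhiP; elim: r => [|i r IH].
  split=> [k f g|q]; first by rewrite !big_nil scaler0 addr0.
  by exists 0%N => f _; rewrite big_nil; exact: ordge_zero.
rewrite [X in clin X](_ : _ = fun f => Phi i f + \sum_(j <- r) Phi j f).
  exact: clin_comb.
by apply/funext => f; rewrite big_cons.
Qed.

Lemma clin_deriv i : clin (fps_deriv i).
Proof.
split=> [k f g|q]; last by exists q.+1 => f; exact: ordge_deriv.
apply/funext => a; rewrite fps_addE fps_scaleE /fps_deriv.
by rewrite fps_addE fps_scaleE mulrnDl mulrnAr.
Qed.

Lemma clin_ext Phi Psi : clin Phi -> clin Psi ->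
  (forall a, Phi (mono a) = Psi (mono a)) -> forall f, Phi f = Psi f.
Proof.
move=> PhiP PsiP PhiPsi f; apply/eqP; rewrite -subr_eq0; apply/eqP.
apply: (clin_eq0 (clin_diff PhiP PsiP) (s := 0)) => // a _.
by rewrite PhiPsi subrr.
Qed.

(** The values [E] prescribed on the monomials may lose at most [c] orders; then
    the coefficient of exponent [a] only depends on monomials of degree at most
    [mdeg a + c], which all lie in the box of that size. *)
Definition lin_ext (c : nat) (E : mexp n -> fpseries K n) f : fpseries K n :=
  fun a => (\sum_(b : {ffun 'I_n -> 'I_(mdeg a + c).+1})
              f (inbox b) *: E (inbox b)) a.

Section LinExt.
Variables (c : nat) (E : mexp n -> fpseries K n).
Hypothesis EP : forall a, ordge (mdeg a - c) (E a).

Lemma lin_ext_clin : clin (lin_ext c E).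
Proof.
split=> [k f g|q].
  apply/funext => a; rewrite fps_addE fps_scaleE /lin_ext !fps_sumE mulr_sumr.
  rewrite -big_split; apply: eq_bigr => b _ /=.
  by rewrite !fps_scaleE fps_addE fps_scaleE mulrDl mulrA.
exists (q + c)%N => f fq a aq; rewrite /lin_ext fps_sumE big1 // => b _.
rewrite fps_scaleE; have [bq|qb] := ltnP (mdeg (inbox b)) (q + c).
  by rewrite fq // mul0r.
by rewrite EP ?mulr0 //; move: qb aq; lia.
Qed.

Lemma lin_ext_mono a : lin_ext c E (mono a) = E a.
Proof.
apply/funext => b; rewrite /lin_ext fps_sumE.
have [ba|ab] := leqP (mdeg a) (mdeg b + c).
  have [a' aE] : exists a' : {ffun 'I_n -> 'I_(mdeg b + c).+1}, inbox a' = a.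
    by apply: inbox_surj => i; apply: leq_trans (mexp_le_deg a i) _.
  rewrite (bigD1 a') //= big1 ?addr0 => [|d da]; rewrite fps_scaleE /mono.
    by rewrite aE eqxx mul1r.
  by rewrite -aE (inj_eq (@inbox_inj n _)) (negbTE da) mul0r.
rewrite big1 => [|d _]; first by rewrite EP //; move: ab; lia.
rewrite fps_scaleE /mono; case: eqP => [->|]; last by rewrite mul0r.
by rewrite EP ?mulr0 //; move: ab; lia.
Qed.

End LinExt.

Definition upow (u : 'I_n -> fpseries K n) a : fpseries K n :=
  \prod_i u i ^+ a i.

Lemma upow0 u : upow u 0 = 1.
Proof. by rewrite /upow big1 // => i _; rewrite ffunE expr0. Qed.

Lemma upowD u a b : upow u (a + b) = upow u a * upow u b.
Proof.
by rewrite /upow -big_split; apply: eq_bigr => i _; rewrite mexpDE exprD.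
Qed.

Lemma upow1 u i : upow u (mexp1 i) = u i.
Proof.
rewrite /upow (bigD1 i) //= ffunE eqxx expr1 big1 ?mulr1 // => j /negbTE ji.
by rewrite ffunE ji.
Qed.

Lemma upow_ord u a : (forall i, ordge 1 (u i)) -> ordge (mdeg a) (upow u a).
Proof.
move=> u1; elim/mexp_ind: a => [|a i IH]; first by rewrite mdeg0.
rewrite upowD upow1 mdegD mdeg_mexp1; exact: ordgeM.
Qed.

Lemma upow_var a : upow (fps_var K (n := n)) a = mono a.
Proof.
elim/mexp_ind: a => [|a i IH]; first by rewrite upow0.
by rewrite upowD upow1 IH -mono1E monoM.
Qed.

Definition subst u : fpseries K n -> fpseries K n := lin_ext 0 (upow u).

Section Subst.
Variable u : 'I_n -> fpseries K n.
Hypothesis u1 : forall i, ordge 1 (u i).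

Lemma subst_clin : clin (subst u).
Proof. by apply: lin_ext_clin => a; rewrite subn0; exact: upow_ord. Qed.

Lemma subst_mono a : subst u (mono a) = upow u a.
Proof. by apply: lin_ext_mono => b; rewrite subn0; exact: upow_ord. Qed.

Lemma subst_var i : subst u (fps_var K i) = u i.
Proof. by rewrite -mono1E subst_mono upow1. Qed.

Lemma subst1 : subst u 1 = 1.
Proof. by rewrite -mono0 subst_mono upow0. Qed.

(** Both sides are continuous and linear in [f] and in [g], and on monomials the
    identity is [upowD]. *)
Lemma substM f g : subst u (f * g) = subst u f * subst u g.
Proof.
have cu := subst_clin.
apply: (clin_ext (clin_comp cu (clin_mulr g))
                 (clin_mul (subst u g) cu)) => a /=.
rewrite mulrC [RHS]mulrC.
apply: (clin_ext (clin_comp cu (clin_mulr _)) (clin_mul (subst u (mono a)) cu)).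
by move=> b /=; rewrite monoM !subst_mono upowD.
Qed.

Lemma subst_ord s f : ordge s f -> ordge s (subst u f).
Proof.
apply: (clin_ord subst_clin) => a sa; rewrite subst_mono.
exact/(ordgeW sa)/upow_ord.
Qed.

Lemma subst_comp w : (forall i, ordge 1 (w i)) ->
  forall f, subst u (subst w f) = subst (fun i => subst u (w i)) f.
Proof.
move=> w1; have uw1 i : ordge 1 (subst u (w i)) by exact: subst_ord.
have wc : clin (subst w).
  by apply: lin_ext_clin => a; rewrite subn0; exact: upow_ord.
have uwc : clin (subst (fun i => subst u (w i))).
  by apply: lin_ext_clin => a; rewrite subn0; exact: upow_ord.
apply: (clin_ext (clin_comp subst_clin wc) uwc) => a /=.
rewrite {2}/subst lin_ext_mono ?{2}/subst ?lin_ext_mono;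
  try by move=> b; rewrite subn0; exact: upow_ord.
elim/mexp_ind: a => [|a i IH]; first by rewrite !upow0 subst1.
by rewrite !upowD !upow1 substM IH.
Qed.

End Subst.

Lemma subst_id f : subst (fps_var K (n := n)) f = f.
Proof.
have x1 i : ordge 1 (fps_var K i : fpseries K n).
  by rewrite -(mdeg_mexp1 i); exact: ordge_mono.
apply: (clin_ext (subst_clin x1) clin_id) => a.
by rewrite subst_mono // upow_var.
Qed.

End Orders.

(** * Weighted norms *)

Section Norms.
Variables (R : realType) (K : fieldType) (v : realValuation R K) (n : nat).
Implicit Types (f g h : fpseries K n) (a b c : mexp n) (r M : R).

(** The bound $\sum_a |f_a| r^{|a|} \le M$, expressed through finite subsums. *)
Definition normle r f M : Prop := forall s : seq (mexp n), uniq s ->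
  \sum_(a <- s) v (f a) * r ^+ mdeg a <= M.

Lemma normle_ge0 r f M : normle r f M -> 0 <= M.
Proof. by move=> /(_ [::] isT); rewrite big_nil. Qed.

Lemma normleW r f M M' : M <= M' -> normle r f M -> normle r f M'.
Proof. by move=> MM' fM s us; apply: le_trans (fM s us) MM'. Qed.

Lemma term_ge0 r f a : 0 <= r -> 0 <= v (f a) * r ^+ mdeg a.
Proof. by move=> r0; rewrite mulr_ge0 ?rval_ge0 ?exprn_ge0. Qed.

Lemma normle_zero r : normle r 0 0.
Proof. by move=> s _; rewrite big1 // => a _; rewrite rval0 mul0r. Qed.

Lemma normleD r f g M M' : 0 <= r ->
  normle r f M -> normle r g M' -> normle r (f + g) (M + M').
Proof.
move=> r0 fM gM s us; apply: le_trans (lerD (fM s us) (gM s us)).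
rewrite -big_split; apply: ler_sum => a _ /=.
by rewrite -mulrDl ler_wpM2r ?exprn_ge0 // fps_addE rvalD.
Qed.

Lemma normleN r f M : normle r f M -> normle r (- f) M.
Proof.
move=> fM s us; apply: le_trans (fM s us); apply: ler_sum => a _.
by rewrite fps_oppE rvalN.
Qed.

Lemma normleB r f g M M' : 0 <= r ->
  normle r f M -> normle r g M' -> normle r (f - g) (M + M').
Proof. by move=> r0 fM gM; apply/normleD/normleN. Qed.

Lemma normleZ r f M (k : K) : normle r f M -> normle r (k *: f) (v k * M).
Proof.
move=> fM s us; apply: le_trans (ler_wpM2l (rval_ge0 v k) (fM s us)).
by rewrite mulr_sumr; apply: ler_sum => a _; rewrite fps_scaleE rvalM mulrA.
Qed.

Lemma normle_sum r (I : Type) (l : seq I) (F : I -> fpseries K n) (M : I -> R) :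
  0 <= r -> (forall i, normle r (F i) (M i)) ->
  normle r (\sum_(i <- l) F i) (\sum_(i <- l) M i).
Proof.
move=> r0 FM; elim: l => [|i l IH].
  by rewrite !big_nil; exact: normle_zero.
by rewrite !big_cons; exact: normleD.
Qed.

(** The balls of the weighted norm are closed for the $x$-adic topology: this
    replaces the completeness of [K]. *)
Lemma normle_lim r f M :
  (forall q, exists2 g, normle r g M & ordge q (f - g)) -> normle r f M.
Proof.
move=> fM s us; have [g gM fg] := fM (\max_(a <- s) mdeg a).+1.
apply: le_trans (gM s us); rewrite big_seq [leRHS]big_seq.
apply: ler_sum => a as_.
suff -> : f a = g a by [].
apply/eqP; rewrite -subr_eq0 -fps_subE fg // ltnS.
exact: (@leq_bigmax_seq _ s xpredT (@mdeg n)).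
Qed.

(** Multiplication by a monomial shifts the coefficients injectively. *)
Lemma normle_mul_mono r c g M : 0 <= r ->
  normle r g M -> normle r (mono K c * g) (r ^+ mdeg c * M).
Proof.
move=> r0 gM s us.
pose d a : mexp n := [ffun i => (a i - c i)%N].
rewrite (bigID (fun a => a == c + d a)) /= [X in _ + X]big1 ?addr0; last first.
  move=> a /eqP ad; rewrite mono_mul_out ?rval0 ?mul0r // => b ab.
  apply: ad; rewrite ab; congr (_ + _).
  by apply/ffunP => i; rewrite !ffunE addKn.
rewrite -big_filter; set t := seq.filter _ s.
have tE a : a \in t -> a = c + d a by rewrite mem_filter => /andP[/eqP].
have ut : uniq [seq d a | a <- t].
  rewrite map_inj_in_uniq ?filter_uniq // => a b /tE aE /tE bE dab.
  by rewrite aE bE dab.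
apply: le_trans (ler_wpM2l (exprn_ge0 _ r0) (gM _ ut)).
rewrite big_map mulr_sumr big_seq [leRHS]big_seq; apply: ler_sum => a /tE aE.
by rewrite {1 2}aE mono_mulD mdegD exprD mulrCA.
Qed.

Lemma normle_mono r a : 0 <= r -> normle r (mono K a) (r ^+ mdeg a).
Proof.
move=> r0; rewrite -[mono K a]mulr1 -[X in normle _ _ X]mulr1.
apply: normle_mul_mono => // s us.
have [s0|s0] := boolP (0 \in s); last first.
  rewrite big_seq big1 // => b bs; rewrite -mono0 /mono.
  by case: eqP bs s0 => [->->//|]; rewrite rval0 mul0r.
rewrite (bigD1_seq 0) //= big1 ?addr0 => [|b /negbTE b0].
  by rewrite -mono0 /mono eqxx rval1 mdeg0 expr0 mulr1.
by rewrite -mono0 /mono b0 rval0 mul0r.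
Qed.

(** The triangle inequality on truncations, where only the monomials of degree
    at least [s] occur. *)
Lemma clin_norm Phi (s : nat) r rho C f M : clin Phi -> 0 <= r -> 0 <= rho ->
  0 <= C ->
  (forall a, (s <= mdeg a)%N ->
     normle r (Phi (mono K a)) (C * rho ^+ mdeg a)) ->
  ordge s f -> normle rho f M -> normle r (Phi f) (C * M).
Proof.
move=> PhiP r0 rho0 C0 PhiM sf fM; apply: normle_lim => q.
have [D /(_ D (leqnn D)) Dq] := clin_trunc PhiP q f.
exists (\sum_(b : {ffun 'I_n -> 'I_D.+1})
          f (inbox b) *: Phi (mono K (inbox b))) => //.
apply: (@normleW _ _ (\sum_(b : {ffun 'I_n -> 'I_D.+1})
    v (f (inbox b)) * (C * rho ^+ mdeg (inbox b)))); last first.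
  apply: normle_sum => // b.
  have [bs|sb] := ltnP (mdeg (inbox b)) s; last exact/normleZ/PhiM.
  by rewrite sf // scale0r rval0 mul0r; exact: normle_zero.
have us : uniq [seq inbox b | b : {ffun 'I_n -> 'I_D.+1}].
  by rewrite map_inj_uniq -?enumT ?enum_uniq //; exact: inbox_inj.
apply: le_trans (ler_wpM2l C0 (fM _ us)); rewrite big_image /= mulr_sumr.
by apply: ler_sum => b _; rewrite mulrCA.
Qed.

Lemma normleM r f g M M' : 0 <= r ->
  normle r f M -> normle r g M' -> normle r (f * g) (M * M').
Proof.
move=> r0 fM gM; rewrite [M * _]mulrC.
apply: (@clin_norm (fun f => f * g) 0) fM => //; [exact: clin_mulr| |].
  exact: normle_ge0 gM.
by move=> a _; rewrite [M' * _]mulrC; apply: normle_mul_mono.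
Qed.

Lemma normleMW r f g M M' B : 0 <= r -> M * M' <= B ->
  normle r f M -> normle r g M' -> normle r (f * g) B.
Proof. by move=> r0 MB fM gM; apply: (normleW MB); exact: normleM. Qed.

(** Shrinking the radius from [r0] to [r] gains a factor $(r / r_0)^{|a|}$ on
    the term of exponent $a$, hence at least $(r / r_0)^s$ on each of them. *)
Lemma normle_scale (s : nat) r r0 f M : 0 < r0 -> 0 <= r <= r0 ->
  ordge s f -> normle r0 f M -> normle r f (M * (r / r0) ^+ s).
Proof.
move=> r0_gt0 /andP[r_ge0 r_le] sf fM t ut.
have q_ge0 : 0 <= r / r0 by rewrite divr_ge0 // ltW.
apply: le_trans (ler_wpM2r (exprn_ge0 s q_ge0) (fM t ut)).
rewrite mulr_suml; apply: ler_sum => a _.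
have [as_|sa] := ltnP (mdeg a) s; first by rewrite sf // rval0 !mul0r.
rewrite -mulrA ler_wpM2l ?rval_ge0 //.
have {1}-> : r = r0 * (r / r0) by rewrite mulrC divfK // gt_eqF.
rewrite exprMn ler_wpM2l ?exprn_ge0 ?(ltW r0_gt0) // ler_wiXn2l //.
by rewrite ler_pdivrMr // mul1r.
Qed.

Lemma convergentE f :
  convergent v f <-> exists2 r, 0 < r & exists M, normle r f M.
Proof.
split=> [/convergentP[r [M [r0 rM]]]|[r r0 [M fM]]].
  exists r => //; exists M => s us.
  apply: le_trans (rM (\max_(a <- s) mdeg a)%N).
  apply: (@sum_uniq_box _ _ (fun a => v (f a) * r ^+ mdeg a)) => //.
    by move=> a; apply: term_ge0 (ltW r0).
  move=> a i as_; apply: leq_trans (mexp_le_deg a i) _.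
  exact: (@leq_bigmax_seq _ s xpredT (@mdeg n)).
apply/convergentP; exists r, M; split=> // N.
have us : uniq [seq inbox b | b : {ffun 'I_n -> 'I_N.+1}].
  by rewrite map_inj_uniq -?enumT ?enum_uniq //; exact: inbox_inj.
by apply: le_trans (fM _ us); rewrite big_image.
Qed.

Lemma cps_convergent (f : cpseries v n) : convergent v f.
Proof. by case: f => f fc; exact/asboolP. Qed.

(** A series of order at least [s] is $O(r^s)$ in norm, as the radius $r$ tends
    to 0; [bigO] makes the constant and the range of radii explicit. *)
Definition bigO (s : nat) (r0 C : R) f : Prop :=
  forall r, 0 < r <= r0 -> normle r f (C * r ^+ s).

Lemma bigOW s r0 r0' C C' f : r0' <= r0 -> C <= C' ->
  bigO s r0 C f -> bigO s r0' C' f.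
Proof.
move=> r0r CC' fC r /andP[rp rr0].
apply: (@normleW _ _ (C * r ^+ s)).
  by rewrite ler_wpM2r ?exprn_ge0 // ltW.
by apply: fC; rewrite rp (le_trans rr0).
Qed.

Lemma bigO_conv s f : ordge s f -> convergent v f ->
  exists r0 C, [/\ 0 < r0, 0 <= C & bigO s r0 C f].
Proof.
move=> sf /convergentE[r0 r0_gt0 [M fM]]; have M0 := normle_ge0 fM.
exists r0, (M * r0^-1 ^+ s); split=> // [|r /andP[r_gt0 rr0]].
  by rewrite mulr_ge0 // exprn_ge0 // invr_ge0 ltW.
rewrite -mulrA -exprMn [_^-1 * _]mulrC; apply: normle_scale => //.
by rewrite (ltW r_gt0).
Qed.

Lemma bigO_family s (J : finType) (h : J -> fpseries K n) :
  (forall j, ordge s (h j)) -> (forall j, convergent v (h j)) ->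
  exists r0 C, [/\ 0 < r0, 0 <= C & forall j, bigO s r0 C (h j)].
Proof.
move=> sh ch.
have {ch sh} hB j : exists r0 C, [/\ 0 < r0, 0 <= C & bigO s r0 C (h j)].
  exact: bigO_conv.
suff [r0 [C [r0_gt0 C_ge0 hC]]] : exists r0 C, [/\ 0 < r0, 0 <= C &
    forall j, j \in enum J -> bigO s r0 C (h j)].
  by exists r0, C; split=> // j; apply: hC; rewrite mem_enum.
elim: (enum J) => [|j l [r0 [C [r0_gt0 C_ge0 hC]]]]; first by exists 1, 0.
have [r1 [C1 [r1_gt0 C1_ge0 hC1]]] := hB j.
exists (Order.min r0 r1), (C + C1); split.
- by rewrite lt_min r0_gt0.
- exact: addr_ge0.
- move=> i; rewrite inE => /orP[/eqP->|/hC].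
    by apply: bigOW hC1; rewrite ?ge_min ?lexx ?orbT ?lerDr.
  by apply: bigOW; rewrite ?ge_min ?lexx ?lerDl.
Qed.

End Norms.

(** * Fixed points, Taylor remainder and inverse functions *)

Section FixedPoints.
Variables (R : realType) (K : fieldType) (v : realValuation R K) (n : nat).
Implicit Types (f g h : fpseries K n) (a b c : mexp n) (r M : R).
Local Notation x := (fps_var K (n := n)).
Local Notation normle := (normle v).

Lemma ordge_sub_trans s f g h :
  ordge s (f - g) -> ordge s (g - h) -> ordge s (f - h).
Proof. by move=> fg gh; rewrite -(subrKA g); exact: ordgeD. Qed.

(** The iterates of 0 form an $x$-adic Cauchy sequence, whose limit exists
    coefficientwise in [K]; it stays in [B] because norm balls are $x$-adically
    closed. *)
Lemma adic_fixpoint (I : Type) (T : (I -> fpseries K n) -> I -> fpseries K n)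
    (N : nat) (r : R) (M : I -> R) :
  (forall i, 0 <= M i) ->
  let B F := forall i, ordge N (F i) /\ normle r (F i) (M i) in
  (forall F, B F -> B (T F)) ->
  (forall s F G, B F -> B G -> (forall i, ordge s (F i - G i)) ->
     forall i, ordge s.+1 (T F i - T G i)) ->
  exists2 F, B F & forall i, T F i = F i.
Proof.
move=> M0 B BT contr.
pose it k := iter k T (fun=> 0).
have itB k : B (it k).
  elim: k => [i|k IH]; last exact: BT.
  by split=> //; apply: (normleW (M0 i)); exact: normle_zero.
have it_step k i : ordge k (it k.+1 i - it k i).
  elim: k i => [//|k IH] i.
  by apply: (contr k (it k.+1) (it k)) => //; exact: itB.
have it_cauchy k j i : ordge k (it (k + j)%N i - it k i).
  elim: j => [|j IH]; first by rewrite addn0 subrr.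
  rewrite addnS; apply: ordge_sub_trans IH.
  by apply: ordgeW (it_step _ i); rewrite leq_addr.
pose F i a := it (mdeg a).+1 i a.
have F_it k i : ordge k (F i - it k i).
  move=> a ak; have := it_cauchy (mdeg a).+1 (k - (mdeg a).+1)%N i a (ltnSn _).
  by rewrite subnKC // fps_subE => /eqP; rewrite subr_eq0 => /eqP E;
    rewrite fps_subE /F E subrr.
have FB : B F.
  move=> i; split=> [a aN|]; first by rewrite /F (itB _ i).1.
  by apply: normle_lim => q; exists (it q i); [exact: (itB q i).2|exact: F_it].
exists F => // i; apply/eqP; rewrite -subr_eq0; apply/eqP.
apply: ordge_eq0 => q; apply: (@ordgeW _ _ q q.+1) => //.
apply: (@ordge_sub_trans _ _ (it q.+1 i)).
  by apply: (contr q F (it q)) => // j; exact: F_it.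
by rewrite -opprB; apply/ordgeN/F_it.
Qed.

Lemma ordge1_var i : ordge 1 (x i).
Proof. by rewrite -(mdeg_mexp1 i); exact: ordge_mono. Qed.

Lemma normle_var r i : 0 <= r -> normle r (x i) r.
Proof.
move=> r0; have := @normle_mono R K v n r (mexp1 i) r0.
by rewrite mdeg_mexp1 expr1.
Qed.

Lemma upow_norm r rho u a : 0 <= r ->
  (forall i, normle r (u i) rho) -> normle r (upow u a) (rho ^+ mdeg a).
Proof.
move=> r0 uM; elim/mexp_ind: a => [|a i IH].
  rewrite upow0 mdeg0 expr0 -[1](@mono0 K n).
  by have := @normle_mono R K v n r 0 r0; rewrite mdeg0 expr0.
by rewrite upowD upow1 mdegD mdeg_mexp1 addn1 exprSr; exact: normleM.
Qed.

Lemma subst_norm r rho u f M : 0 <= r -> 0 <= rho ->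
  (forall i, ordge 1 (u i)) -> (forall i, normle r (u i) rho) ->
  normle rho f M -> normle r (subst u f) M.
Proof.
move=> r0 rho0 u1 uM fM; rewrite -[M]mul1r.
apply: (clin_norm (s := 0) (subst_clin u1)) fM => // a _.
by rewrite subst_mono // mul1r; exact: upow_norm.
Qed.

(** Telescoping the product, $u^a - w^a$ is a combination of the $u_i - w_i$
    with coefficients of order at least $|a| - 1$. *)
Lemma subst_sub_ord q s t u w f : (t <= q + s)%N ->
  (forall i, ordge 1 (u i)) -> (forall i, ordge 1 (w i)) ->
  (forall i, ordge s.+1 (u i - w i)) -> ordge q f ->
  ordge t (subst u f - subst w f).
Proof.
move=> tqs u1 w1 uw fq.
apply: (clin_ord (clin_diff (subst_clin u1) (subst_clin w1))) fq => a qa.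
rewrite !subst_mono //; apply: (@ordgeW _ _ t (mdeg a + s)); first by lia.
elim/mexp_ind: a {qa} => [|a i IH]; first by rewrite !upow0 subrr.
rewrite !upowD !upow1.
have -> : upow u a * u i - upow w a * w i =
  (upow u a - upow w a) * u i + upow w a * (u i - w i) by ring.
rewrite mdegD mdeg_mexp1; apply: ordgeD.
  by apply: ordgeMW _ IH (u1 i); lia.
  by apply: ordgeMW _ (@upow_ord K n w a w1) (uw i); lia.
Qed.

(** The derivative of [f] along the vector field [y]. *)
Definition jac (y : 'I_n -> fpseries K n) f : fpseries K n :=
  \sum_i fps_deriv i f * y i.

Definition taylor_rem y f : fpseries K n :=
  subst (fun i => x i + y i) f - f - jac y f.

Lemma ordge1_shift s y : (forall i, ordge s.+1 (y i)) ->
  forall i, ordge 1 (x i + y i).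
Proof.
move=> ys i; apply: ordgeD; first exact: ordge1_var.
exact: ordgeW (ys i).
Qed.

Lemma jac_clin y : clin (jac y).
Proof. by apply: clin_bigsum => i; apply/clin_mul/clin_deriv. Qed.

Lemma taylor_rem_clin s y : (forall i, ordge s.+1 (y i)) -> clin (taylor_rem y).
Proof.
move=> ys; apply: clin_diff (jac_clin y); apply: clin_diff (@clin_id K n).
exact/subst_clin/ordge1_shift.
Qed.

Lemma jacB y w f : jac y f - jac w f = jac (fun i => y i - w i) f.
Proof.
by rewrite /jac -sumrB; apply: eq_bigr => i _; rewrite mulrBr.
Qed.

Lemma jac_one y : jac y 1 = 0.
Proof.
rewrite /jac big1 // => i _; rewrite (_ : fps_deriv i 1 = 0) ?mul0r //.
apply/funext => a; rewrite /fps_deriv -(@mono0 K n) /mono.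
case: eqP => [/(congr1 (@mdeg n))|_]; last by rewrite mul0rn.
by rewrite mdegD mdeg_mexp1 mdeg0; lia.
Qed.

(** On the coefficient of exponent $b = e_j + c$ with $j = i$, this Leibniz rule
    is the identity $c_i + 2 = (c_i + 1) + 1$; the exponents with $b_j = 0$, where
    the first term vanishes, are treated apart. *)
Lemma deriv_mulX i j a : fps_deriv i (mono K (a + mexp1 j)) =
  x j * fps_deriv i (mono K a) + (i == j)%:R *: mono K a.
Proof.
apply/funext => b; rewrite fps_addE fps_scaleE -mono1E.
have [[c ->]|nb] := pselect (exists c, b = mexp1 j + c).
  rewrite mono_mulD /fps_deriv /mono mexpDE [mexp1 j i]ffunE.
  have -> : (mexp1 j + c + mexp1 i == a + mexp1 j) = (c + mexp1 i == a).
    apply/eqP/eqP => [|<-]; last by rewrite -addrA addrC.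
    by rewrite -addrA [a + _]addrC => /mexp_addI.
  have [->|ij] := eqVneq i j; last by rewrite mul0r addr0 add0n.
  by rewrite mul1r [mexp1 j + c]addrC add1n [RHS]addrC mulrS.
rewrite mono_mul_out => [|c bc]; last by apply: nb; exists c.
rewrite add0r /fps_deriv /mono.
have bj : b j = 0%N.
  apply/eqP; rewrite -leqn0 leqNgt; apply/negP => bj; apply: nb.
  exists [ffun k => (b k - (k == j))%N]; apply/ffunP => k.
  by rewrite mexpDE !ffunE; case: eqP => [->|]; rewrite ?subnKC // subn0.
have [->|ij] := eqVneq i j.
  rewrite bj mulr1n mul1r; congr ((nat_of_bool _)%:R); apply/eqP/eqP => [|->//].
  by rewrite addrC [RHS]addrC => /mexp_addI.
case: eqP => [/ffunP/(_ j)|_]; last by rewrite mul0rn mul0r.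
by rewrite !mexpDE !ffunE bj eqxx eq_sym (negbTE ij); lia.
Qed.

Lemma jac_mulX y a j : jac y (mono K (a + mexp1 j)) =
  x j * jac y (mono K a) + mono K a * y j.
Proof.
rewrite /jac mulr_sumr.
under eq_bigr => i _ do rewrite deriv_mulX mulrDl -mulrA.
rewrite big_split /=; congr (_ + _).
rewrite (bigD1 j) //= eqxx scale1r big1 ?addr0 // => i /negbTE ->.
by rewrite scale0r mul0r.
Qed.

(** This recursion holds in every characteristic and replaces the expansion of
    the remainder with divided derivatives: it shows at once that the remainder
    is quadratic in [y], both for orders and for norms. *)
Lemma taylor_rem_mulX s y a j : (forall i, ordge s.+1 (y i)) ->
  taylor_rem y (mono K (a + mexp1 j)) =
  (x j + y j) * taylor_rem y (mono K a) + y j * jac y (mono K a).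
Proof.
move=> ys; have xy1 := ordge1_shift ys.
rewrite /taylor_rem jac_mulX -monoM mono1E substM // subst_var //.
by ring.
Qed.

Lemma taylor_rem_one s y : (forall i, ordge s.+1 (y i)) -> taylor_rem y 1 = 0.
Proof.
move=> ys; rewrite /taylor_rem jac_one subst1 ?subrr ?subr0 //.
exact: ordge1_shift ys.
Qed.

Lemma jac_mono_ord s y a : (forall i, ordge s.+1 (y i)) ->
  ordge (mdeg a + s) (jac y (mono K a)).
Proof.
move=> ys; elim/mexp_ind: a => [|a j IH]; first by rewrite mono0 jac_one.
rewrite jac_mulX mdegD mdeg_mexp1; apply: ordgeD.
  by apply: ordgeMW _ (@ordge1_var j) IH; lia.
by apply: ordgeMW _ (@ordge_mono K n a) (ys j); lia.
Qed.

Lemma jac_ord q s t y f : (t <= q + s)%N -> (forall i, ordge s.+1 (y i)) ->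
  ordge q f -> ordge t (jac y f).
Proof.
move=> tqs ys; apply: (clin_ord (jac_clin y)) => a qa.
by apply: ordgeW (@jac_mono_ord s y a ys); lia.
Qed.

Lemma taylor_rem_mono_ord s y a : (forall i, ordge s.+1 (y i)) ->
  ordge (mdeg a + s + s) (taylor_rem y (mono K a)).
Proof.
move=> ys; elim/mexp_ind: a => [|a j IH].
  by rewrite mono0 (taylor_rem_one ys).
rewrite (taylor_rem_mulX _ _ ys) mdegD mdeg_mexp1; apply: ordgeD.
  by apply: ordgeMW _ (ordge1_shift ys j) IH; lia.
by apply: ordgeMW _ (ys j) (@jac_mono_ord s y a ys); lia.
Qed.

Lemma taylor_rem_ord q s t y f : (t <= q + s + s)%N ->
  (forall i, ordge s.+1 (y i)) -> ordge q f -> ordge t (taylor_rem y f).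
Proof.
move=> tqs ys; apply: (clin_ord (taylor_rem_clin ys)) => a qa.
by apply: ordgeW (@taylor_rem_mono_ord s y a ys); lia.
Qed.

(** The remainder is quadratic, so that its variation gains the orders of both
    [y] and the variation of [y]. *)
Lemma taylor_rem_sub_ord q s s' t y w f : (t <= q + s + s')%N ->
  (forall i, ordge s.+1 (y i)) -> (forall i, ordge s.+1 (w i)) ->
  (forall i, ordge s'.+1 (y i - w i)) -> ordge q f ->
  ordge t (taylor_rem y f - taylor_rem w f).
Proof.
move=> tqs ys ws yw.
have cyw := clin_diff (taylor_rem_clin ys) (taylor_rem_clin ws).
apply: (clin_ord cyw) => a qa; apply: (@ordgeW _ _ t (mdeg a + s + s')).
  by lia.
elim/mexp_ind: a {qa} => [|a j IH].
  by rewrite mono0 (taylor_rem_one ys) (taylor_rem_one ws) subrr.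
rewrite (taylor_rem_mulX _ _ ys) (taylor_rem_mulX _ _ ws) mdegD mdeg_mexp1.
have -> : (x j + y j) * taylor_rem y (mono K a) + y j * jac y (mono K a) -
    ((x j + w j) * taylor_rem w (mono K a) + w j * jac w (mono K a)) =
  (x j + y j) * (taylor_rem y (mono K a) - taylor_rem w (mono K a)) +
  (y j - w j) * taylor_rem w (mono K a) + (y j - w j) * jac y (mono K a) +
  w j * (jac y (mono K a) - jac w (mono K a)) by ring.
rewrite jacB; do 3?apply: ordgeD.
- by apply: ordgeMW _ (ordge1_shift ys j) IH; lia.
- by apply: ordgeMW _ (yw j) (@taylor_rem_mono_ord s w a ws); lia.
- by apply: ordgeMW _ (yw j) (@jac_mono_ord s y a ys); lia.
- by apply: ordgeMW _ (ws j) (@jac_mono_ord s' _ a yw); lia.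
Qed.

Section TaylorNorm.
Variables (s : nat) (y : 'I_n -> fpseries K n) (r q : R).
Hypotheses (r0 : 0 <= r) (q0 : 0 <= q).
Hypothesis ys : forall i, ordge s.+1 (y i).
Hypothesis yM : forall i, normle r (y i) (q * r).

(** The factor [4] on the radius absorbs the degree $|a|$ that differentiation
    produces; the ratio [q] of the norm of [y] to [r] measures the gain. *)
Lemma jac_norm f M : normle (4 * r) f M -> normle r (jac y f) (q * M).
Proof.
have r4 : 0 <= 4 * r by rewrite mulr_ge0.
apply: (clin_norm (s := 0) (jac_clin y)) => // a _.
elim/mexp_ind: a => [|a j IH].
  rewrite mono0 jac_one mdeg0 expr0 mulr1; apply: (normleW q0).
  exact: normle_zero.
rewrite jac_mulX mdegD mdeg_mexp1 addn1.
have le1 : r ^+ mdeg a <= (4 * r) ^+ mdeg a by rewrite lerXn2r ?nnegrE //; lra.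
apply: normleW (normleD r0 (normleM r0 (normle_var j r0) IH)
                  (normleM r0 (normle_mono v a r0) (yM j))).
rewrite exprS; set A := (4 * r) ^+ _ in le1 *; set B := r ^+ _ in le1 *.
have A0 : 0 <= A by rewrite exprn_ge0.
have qr0 : 0 <= q * r by rewrite mulr_ge0.
have := ler_wpM2l qr0 le1; have : 0 <= q * r * A by rewrite mulr_ge0.
by move=> h1 h2; lra.
Qed.

Lemma taylor_rem_norm f M : q <= 1 ->
  normle (4 * r) f M -> normle r (taylor_rem y f) (q ^+ 2 * M).
Proof.
move=> q1; have r4 : 0 <= 4 * r by rewrite mulr_ge0.
have qq0 : 0 <= q ^+ 2 by rewrite exprn_ge0.
apply: (clin_norm (s := 0) (taylor_rem_clin ys)) => // a _.
elim/mexp_ind: a => [|a j IH].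
  rewrite mono0 (taylor_rem_one ys) mdeg0 expr0 mulr1; apply: (normleW qq0).
  exact: normle_zero.
rewrite (taylor_rem_mulX _ _ ys) mdegD mdeg_mexp1 addn1.
have jacM : normle r (jac y (mono K a)) (q * (4 * r) ^+ mdeg a).
  exact/jac_norm/normle_mono.
apply: normleW (normleD r0 (normleM r0 (normleD r0 (normle_var j r0) (yM j)) IH)
                  (normleM r0 (yM j) jacM)).
rewrite [(4 * r) ^+ _.+1]exprS; set A := (4 * r) ^+ _.
have A0 : 0 <= r * (q ^+ 2 * A) by rewrite !mulr_ge0 // exprn_ge0.
have : q * (r * (q ^+ 2 * A)) <= r * (q ^+ 2 * A) by exact: ler_piMl.
by move=> h; lra.
Qed.

End TaylorNorm.

(** The inverse is the fixed point of $u \mapsto x - y(u)$, which is contracting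
    because [y] has order at least 2. *)
Lemma tangent_inverse y : (forall i, ordge 2 (y i)) ->
  (forall i, convergent v (y i)) ->
  exists w, [/\ forall i, ordge 2 (w i), forall i, convergent v (w i) &
    forall i, subst (fun j => x j + w j) (x i + y i) = x i].
Proof.
move=> y2 yc; have [r0 [C [r0_gt0 C_ge0 yC]]] := bigO_family y2 yc.
pose r := r0 / (2 * (1 + 2 * C * r0)).
have den_gt0 : 0 < 2 * (1 + 2 * C * r0).
  by rewrite mulr_gt0 // ltr_wpDr // !mulr_ge0 // ltW.
have r_gt0 : 0 < r by rewrite divr_gt0.
have rE : 2 * r + 4 * C * r * r0 = r0.
  by rewrite /r; field; rewrite gt_eqF //; move: den_gt0; lra.
clearbody r.
have r_le : 2 * r <= r0.
  by rewrite -[leRHS]rE lerDl !mulr_ge0 // ltW.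
have Cr : 4 * C * r <= 1.
  rewrite -(ler_pM2r r0_gt0) mul1r -[leRHS]rE lerDr mulr_ge0 // ltW //.
have r2_ge0 : 0 <= 2 * r by rewrite mulr_ge0 // ltW.
have [i|T|s F G|u uB uE] := @adic_fixpoint 'I_n
    (fun u i => x i - subst u (y i)) 1 r (fun=> 2 * r).
- exact: r2_ge0.
- move=> TB i; split.
    apply: ordgeB; first exact: ordge1_var.
    apply: (@ordgeW _ _ 1 2) => //; apply: subst_ord (y2 i) => j.
    by case: (TB j).
  (* Since [u] has norm at most [2 * r], the norm of [y (u)] is at most
     [C * (2 * r) ^ 2], and the choice of [r] makes it at most [r]. *)
  have -> : 2 * r = r + r by ring.
  apply: normleB; [exact: ltW|exact/normle_var/ltW|].
  apply: (@subst_norm _ (2 * r)) => //; first exact: ltW.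
  + by move=> j; case: (TB j).
  + by move=> j; case: (TB j).
  apply: normleW (yC i (2 * r) _); last by rewrite mulr_gt0.
  have -> : C * (2 * r) ^+ 2 = (4 * C * r) * r by ring.
  by rewrite ler_piMl // ltW.
- move=> FB GB FG i.
  have -> : x i - subst F (y i) - (x i - subst G (y i)) =
    - (subst F (y i) - subst G (y i)) by ring.
  apply/ordgeN/(@subst_sub_ord 2 s.-1) => //; first by lia.
  + by move=> j; case: (FB j).
  + by move=> j; case: (GB j).
  move=> j; case: s FG => [|s] FG; last exact: FG.
  by apply: ordgeB; [case: (FB j)|case: (GB j)].
have u1 i : ordge 1 (u i) by case: (uB i).
have uE' i : u i = x i + - subst u (y i) by rewrite -[LHS]uE.
exists (fun i => - subst u (y i)); split=> i.
- exact/ordgeN/subst_ord.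
- rewrite (_ : - _ = u i - x i); last by rewrite uE' addrC addKr.
  apply/convergentE; exists r => //; exists (2 * r + r).
  by apply: normleB; [exact: ltW|case: (uB i)|exact/normle_var/ltW].
rewrite -(funext uE') clinD; last exact: subst_clin.
by rewrite subst_var // uE' subrK.
Qed.

(** The inverse is the fixed point of $w \mapsto 1 - z w$. *)
Lemma unit_inverse z : ordge 1 z -> convergent v z ->
  exists2 w : fpseries K n, convergent v w & w * (1 + z) = 1.
Proof.
move=> z1 zc; have [r0 [C [r0_gt0 C_ge0 zC]]] := bigO_conv z1 zc.
pose r := r0 / (1 + 2 * C * r0).
have den_gt0 : 0 < 1 + 2 * C * r0 by rewrite ltr_wpDr // !mulr_ge0 // ltW.
have r_gt0 : 0 < r by rewrite divr_gt0.
have rE : r + 2 * C * r * r0 = r0.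
  by rewrite /r; field; rewrite gt_eqF //; move: den_gt0; lra.
clearbody r.
have r_le : r <= r0 by rewrite -[leRHS]rE lerDl !mulr_ge0 // ltW.
have Cr : 2 * (C * r) <= 1.
  rewrite -(ler_pM2r r0_gt0) mul1r -[leRHS]rE; move: r_gt0; lra.
have [i|T|s F G|w wB wE] :=
  @adic_fixpoint unit (fun w i => 1 - z * w i) 0 r (fun=> 2).
- by [].
- move=> TB i; split=> //; have -> : 2 = 1 + 1 :> R by ring.
  apply: normleB; first exact: ltW.
    by have := @normle_mono R K v n r 0 (ltW r_gt0); rewrite mdeg0 expr0.
  have zM : normle r z (C * r ^+ 1) by apply: zC; rewrite r_gt0.
  apply: normleMW (ltW r_gt0) _ zM (TB i).2.
  by rewrite expr1 mulrC.
- move=> FB GB FG i.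
  have -> : 1 - z * F i - (1 - z * G i) = - (z * (F i - G i)) by ring.
  by apply/ordgeN/(ordgeM z1)/FG.
exists (w tt).
  by apply/convergentE; exists r => //; exists 2; case: (wB tt).
by rewrite mulrDr mulr1 [w tt * z]mulrC -{1}(wE tt) subrK.
Qed.

End FixedPoints.

(** * Solving the perturbed equation *)

Section Solving.
Variables (R : realType) (K : fieldType) (v : realValuation R K) (n : nat).
Implicit Types (f g h : fpseries K n) (a b c : mexp n) (r M : R).
Local Notation x := (fps_var K (n := n)).
Local Notation normle := (normle v).
Local Notation bigO := (bigO v).

Lemma mexp_split N a : (N <= mdeg a)%N ->
  exists b c, a = b + c /\ mdeg b = N.
Proof.
elim/mexp_ind: a => [|a i IH].
  rewrite mdeg0 leqn0 => /eqP ->.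
  by exists 0, 0; rewrite addr0 mdeg0.
rewrite mdegD mdeg_mexp1 addn1 leq_eqVlt => /orP[/eqP ->|].
  by exists (a + mexp1 i), 0; rewrite addr0 mdegD mdeg_mexp1 addn1.
rewrite ltnS => /IH[b [c [-> bN]]].
by exists b, (c + mexp1 i); rewrite addrA.
Qed.

Lemma mexp_split_fun N : exists sp : mexp n -> {ffun 'I_n -> 'I_N.+1} * mexp n,
  forall a, (N <= mdeg a)%N ->
    a = inbox (sp a).1 + (sp a).2 /\ mdeg (inbox (sp a).1) = N.
Proof.
pose P a (p : {ffun 'I_n -> 'I_N.+1} * mexp n) := (N <= mdeg a)%N ->
  a = inbox p.1 + p.2 /\ mdeg (inbox p.1) = N.
suff /choice[sp spP] : forall a, exists p, P a p by exists sp.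
move=> a; have [aN|Na] := ltnP (mdeg a) N.
  by exists ([ffun=> ord0], 0); rewrite /P leqNgt aN.
have [b [c [aE bN]]] := mexp_split Na.
have [b' bE] : exists b' : {ffun 'I_n -> 'I_N.+1}, inbox b' = b.
  by apply: inbox_surj => i; rewrite -bN mexp_le_deg.
by exists (b', c) => _; rewrite /= bE.
Qed.

(** Every monomial $x^a$ of degree at least [N] is given a factor of degree
    exactly [N], namely $x^d$ with $d$ the first component of [sp a].  Replacing
    that factor by [h d] and extending by linearity and continuity multiplies
    each part of the series by $h_d / x^d$: if all the monomials of degree [N]
    belong to an ideal, this produces the coefficients of any series of order
    [N] on the generators, with control of orders and norms. *)
Section Division.
Variables (N : nat) (sp : mexp n -> {ffun 'I_n -> 'I_N.+1} * mexp n).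
Hypothesis spP : forall a, (N <= mdeg a)%N ->
  a = inbox (sp a).1 + (sp a).2 /\ mdeg (inbox (sp a).1) = N.

Definition div_family (h : {ffun 'I_n -> 'I_N.+1} -> fpseries K n) a :
    fpseries K n :=
  if (N <= mdeg a)%N then mono K (sp a).2 * h (sp a).1 else 0.

Definition div_sum (h : {ffun 'I_n -> 'I_N.+1} -> fpseries K n) :
    fpseries K n -> fpseries K n := lin_ext N (div_family h).

Variable h : {ffun 'I_n -> 'I_N.+1} -> fpseries K n.

Lemma sp_deg a : (N <= mdeg a)%N -> mdeg a = (N + mdeg (sp a).2)%N.
Proof. by move=> /spP[/(congr1 (@mdeg n)) + aN]; rewrite mdegD aN. Qed.

Lemma div_family_ord p a : (forall d, ordge p (h d)) ->
  ordge (mdeg a - N + p) (div_family h a).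
Proof.
move=> hp; rewrite /div_family; case: ifP => // /sp_deg aE.
by apply: ordgeMW _ (@ordge_mono K n (sp a).2) (hp _); lia.
Qed.

Lemma div_family_ord0 a : ordge (mdeg a - N) (div_family h a).
Proof. by rewrite -[(_ - _)%N]addn0; exact: div_family_ord. Qed.

Lemma div_sum_clin : clin (div_sum h).
Proof. exact/lin_ext_clin/div_family_ord0. Qed.

Lemma div_sum_mono a : div_sum h (mono K a) = div_family h a.
Proof. exact/lin_ext_mono/div_family_ord0. Qed.

Lemma div_sum_ord p s t f : (t <= s + p)%N -> (forall d, ordge p (h d)) ->
  ordge (N + s) f -> ordge t (div_sum h f).
Proof.
move=> tsp hp; apply: (clin_ord div_sum_clin) => a sa.
by rewrite div_sum_mono; apply: ordgeW (div_family_ord hp); lia.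
Qed.

Lemma div_sum_norm p r0 C r M f : 0 <= C -> 0 < r <= r0 ->
  (forall d, bigO p r0 C (h d)) -> ordge N f -> normle r f (M * r ^+ N) ->
  normle r (div_sum h f) (C * M * r ^+ p).
Proof.
move=> C0 rr0 hC fN fM; have /andP[r_gt0 _] := rr0.
have r_ge0 := ltW r_gt0; have rN0 : r ^+ N != 0 by rewrite expf_neq0 // gt_eqF.
have -> : C * M * r ^+ p = (C * r ^+ p / r ^+ N) * (M * r ^+ N).
  by field.
apply: (clin_norm div_sum_clin) fN fM => //.
  by rewrite !mulr_ge0 ?exprn_ge0 // invr_ge0 exprn_ge0.
move=> a Na; rewrite div_sum_mono /div_family Na (sp_deg Na) exprD.
have -> : C * r ^+ p / r ^+ N * (r ^+ N * r ^+ mdeg (sp a).2) =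
  r ^+ mdeg (sp a).2 * (C * r ^+ p) by field.
by apply: normle_mul_mono => //; exact: hC.
Qed.

Lemma div_sum0 f : (forall d, h d = 0) -> div_sum h f = 0.
Proof.
move=> h0; apply: (clin_eq0 div_sum_clin (s := 0)) => // a _.
by rewrite div_sum_mono /div_family h0 mulr0 if_same.
Qed.

End Division.

Section Solve.
Variables (f G : fpseries K n) (o e N : nat).
Hypotheses (oeN : N = (o + e.*2.+1)%N) (fo : ordge o f) (GN : ordge N G).
Hypotheses (fc : convergent v f) (Gc : convergent v G).
Variables (z : {ffun 'I_n -> 'I_N.+1} -> fpseries K n)
  (y : {ffun 'I_n -> 'I_N.+1} -> 'I_n -> fpseries K n).
Hypotheses (ze : forall d, ordge e.+1 (z d))
  (zc : forall d, convergent v (z d)).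
Hypotheses (ye : forall d i, ordge e.+2 (y d i))
  (yc : forall d i, convergent v (y d i)).
Hypothesis zyP : forall d, mdeg (inbox d) = N ->
  mono K (inbox d) = z d * f + jac (y d) f.

(** Taking for [Z] and [Y] the coefficients of [F] obtained by division, the
    equation becomes a fixed point equation in the single unknown [F] of order
    at least [N]. *)
Lemma perturbed_equation_solvable : exists Z Y,
  [/\ ordge e.+1 Z /\ convergent v Z,
      (forall i, ordge e.+2 (Y i)) /\ (forall i, convergent v (Y i)),
      (1 + Z) * subst (fun i => x i + Y i) f = f + G &
      (forall d, z d = 0) -> Z = 0].
Proof.
(* The order counts behind the contraction: the remainder, and the products of
   [Z] with series of the order of the jacobian part, all gain one order. *)
have leR t : ((N + t).+1 <= o + e.+1 + (e + t).+1)%N by lia.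
have leR0 : (N.+1 <= o + e.+1 + e.+1)%N by lia.
have leJ t : ((N + t).+1 <= (e + t).+1 + (o + e.+1))%N by lia.
have leZJ : (N.+1 <= e.+1 + (o + e.+1))%N by lia.
have leJ' t : ((N + t).+1 <= e.+1 + (o + (e + t).+1))%N by lia.
have leN t : (o + (e + t).+1 <= (N + t).+1)%N by lia.
have leNM s : (s.+1 <= (N + (s - N)).+1)%N by lia.
have eE : (e.+1 * 2 = e.*2.+1.+1)%N by lia.
have [sp spP] := mexp_split_fun N.
pose DZ := div_sum sp z; pose DY F i := div_sum sp (y^~ i) F.
have DZe s F : ordge (N + s) F -> ordge (e + s).+1 (DZ F).
  by move=> FN; apply: (div_sum_ord spP _ ze FN); lia.
have DYe s F i : ordge (N + s) F -> ordge (e + s).+2 (DY F i).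
  by move=> FN; apply: (div_sum_ord spP _ (ye^~ i) FN); lia.
have DY_ord1 F : ordge N F -> forall i, ordge e.+2 (DY F i).
  by move=> FN i; rewrite -[e]addn0; apply: DYe; rewrite addn0.
have DZ_ord1 F : ordge N F -> ordge e.+1 (DZ F).
  by move=> FN; rewrite -[e]addn0; apply: DZe; rewrite addn0.
have DP F : ordge N F -> DZ F * f + jac (DY F) f = F.
  move=> FN; apply/eqP; rewrite -subr_eq0; apply/eqP.
  pose Phi F := DZ F * f + (\sum_i DY F i * fps_deriv i f) - F.
  have PhiP : clin Phi.
    apply: clin_diff (@clin_id K n); apply: clin_comb.
      exact/clin_mul/div_sum_clin.
    by apply: clin_bigsum => i; exact/clin_mul/div_sum_clin.
  transitivity (Phi F).
    rewrite /Phi /jac; congr (_ + _ - _).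
    by apply: eq_bigr => i _; rewrite mulrC.
  apply: (clin_eq0 PhiP) FN => a Na; rewrite /Phi /DZ div_sum_mono //.
  have [aE aN] := spP _ Na.
  have {2}-> : mono K a =
      mono K (sp a).2 * (z (sp a).1 * f + jac (y (sp a).1) f).
    by rewrite -zyP // monoM addrC -aE.
  rewrite /div_family Na /jac mulrDr mulrA mulr_sumr.
  rewrite [X in _ + X - _](_ : _ =
    \sum_i mono K (sp a).2 * (fps_deriv i f * y (sp a).1 i)) ?subrr //.
  apply: eq_bigr => i _; rewrite /DY div_sum_mono // /div_family Na.
  by rewrite -mulrA [y _ _ * _]mulrC.
have [r1 [Cf [r1_gt0 Cf0 fO]]] := bigO_conv fo fc.
have [r2 [CG [r2_gt0 CG0 GO]]] := bigO_conv GN Gc.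
have [r3 [Cz [r3_gt0 Cz0 zO]]] := bigO_family ze zc.
have [r4 [Cy [r4_gt0 Cy0 yO]]] :=
  @bigO_family R K v n e.+2 _
    (fun p : {ffun 'I_n -> 'I_N.+1} * 'I_n => y p.1 p.2)
    (fun p => ye p.1 p.2) (fun p => yc p.1 p.2).
pose C := 1 + Cf + CG + Cz + Cy.
have C1 : 1 <= C by rewrite /C; lra.
pose r0 := Order.min 1 (Order.min (Order.min r1 r2) (Order.min r3 r4)).
have r0_gt0 : 0 < r0 by rewrite !lt_min ltr01 r1_gt0 r2_gt0 r3_gt0.
have r0_le1 : r0 <= 1 by rewrite ge_min lexx.
have {r1_gt0}fO : bigO o r0 C f.
  by apply: bigOW fO; rewrite ?ge_min ?lexx ?orbT // /C; lra.
have {r2_gt0}GO : bigO N r0 C G.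
  by apply: bigOW GO; rewrite ?ge_min ?lexx ?orbT // /C; lra.
have {r3_gt0}zO d : bigO e.+1 r0 C (z d).
  by apply: bigOW (zO d); rewrite ?ge_min ?lexx ?orbT // /C; lra.
have {r4_gt0}yO d i : bigO e.+2 r0 C (y d i).
  by apply: bigOW (yO (d, i)); rewrite ?ge_min ?lexx ?orbT // /C; lra.
clearbody r0 C => {r1 r2 r3 r4 Cf CG Cz Cy Cf0 CG0 Cz0 Cy0}.
(* [A * r ^+ N.+1] will bound each of the three nonlinear terms; the radius [r]
   is such that their sum is at most half of the allowed [M * r ^+ N], the other
   half being left to the norm of [G]. *)
pose M := 2 * C; pose A := (C * M) ^+ 2 * C * 4 ^+ o.
have C0 : 0 <= C by lra.
have M0 : 0 <= M by rewrite /M; lra.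
have A0 : 0 <= A by rewrite !mulr_ge0 // ?exprn_ge0 ?mulr_ge0.
pose den := 4 + C * M + 3 * A.
have CM0 : 0 <= C * M by rewrite mulr_ge0.
have den_gt0 : 0 < den by rewrite /den; lra.
pose r := r0 / den.
have r_gt0 : 0 < r by rewrite divr_gt0.
have rE : den * r = r0 by rewrite /r mulrC divfK // gt_eqF.
clearbody r.
have r_ge0 := ltW r_gt0.
have rCM0 : 0 <= C * M * r by rewrite mulr_ge0.
have rA0 : 0 <= A * r by rewrite mulr_ge0.
have [r4_le rCM rA] : [/\ 4 * r <= r0, C * M * r <= 1 & 3 * (A * r) <= 1].
  by split; move: rE; rewrite /den; nra.
have r_le : r <= r0 by lra.
have r_le1 : r <= 1 by lra.
have rr0 : 0 < r <= r0 by rewrite r_gt0.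
(* [q] bounds the norm of [Z], and [q * r] that of each [Y i]. *)
pose q := C * M * r ^+ e.+1.
have q0 : 0 <= q by rewrite mulr_ge0 // exprn_ge0.
have q1 : q <= 1.
  apply: le_trans rCM; rewrite /q ler_wpM2l // exprS ler_piMr //.
  by rewrite exprn_ile1.
pose T (F : unit -> fpseries K n) i := G - taylor_rem (DY (F i)) f -
  DZ (F i) * (jac (DY (F i)) f + taylor_rem (DY (F i)) f).
have DZ_norm F : ordge N F -> normle r F (M * r ^+ N) -> normle r (DZ F) q.
  by move=> FN FM; exact: (div_sum_norm spP C0 rr0 zO FN FM).
have DY_norm F : ordge N F -> normle r F (M * r ^+ N) ->
    forall i, normle r (DY F i) (q * r).
  move=> FN FM i; rewrite /q -mulrA -exprSr.
  exact: (div_sum_norm spP C0 rr0 (yO^~ i) FN FM).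
have f4 : normle (4 * r) f (C * (4 * r) ^+ o).
  by apply: fO; rewrite r4_le mulr_gt0.
have JR_ord F : ordge N F ->
    ordge (o + e.+1) (jac (DY F) f + taylor_rem (DY F) f).
  move=> FN; apply: ordgeD; first exact: (jac_ord (leqnn _) (DY_ord1 _ FN) fo).
  exact: (taylor_rem_ord (leq_addr _ _) (DY_ord1 _ FN) fo).
have [i|F FB|s F H FB HB FH|F FB FE] :=
  @adic_fixpoint R K v n unit T N r (fun=> M * r ^+ N).
- by rewrite mulr_ge0 // exprn_ge0.
- move=> i; have [FN FM] := FB i; split.
    apply: ordgeB; first apply: ordgeB => //.
      exact/(ordgeW (leqnSn N))/(taylor_rem_ord leR0 (DY_ord1 _ FN) fo).
    exact/(ordgeW (leqnSn N))/(ordgeMW leZJ (DZ_ord1 _ FN))/JR_ord.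
  have RM := taylor_rem_norm r_ge0 q0 (DY_ord1 _ FN) (DY_norm _ FN FM) q1 f4.
  have JM := jac_norm r_ge0 q0 (DY_norm _ FN FM) f4.
  apply: normleW (normleB r_ge0 (normleB r_ge0 (GO _ rr0) RM)
    (normleM r_ge0 (DZ_norm _ FN FM) (normleD r_ge0 JM RM))).
  have AE : q ^+ 2 * (C * (4 * r) ^+ o) = A * r * r ^+ N.
    have -> : q ^+ 2 = (C * M) ^+ 2 * (r * r ^+ e.*2.+1).
      by rewrite /q exprMn -exprM eE [r ^+ _.+2]exprS.
    rewrite oeN [(4 * r) ^+ o]exprMn [r ^+ (_ + _)]exprD /A. by ring.
  have h : q * (q ^+ 2 * (C * (4 * r) ^+ o)) <= q ^+ 2 * (C * (4 * r) ^+ o).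
    by rewrite ler_piMl // AE mulr_ge0 // exprn_ge0.
  have : 3 * (A * r) * r ^+ N <= C * r ^+ N.
    by rewrite ler_wpM2r ?exprn_ge0 // (le_trans rA).
  move: h; set X := C * _ ^+ o; rewrite -/X in AE *.
  have -> : q * (q * X + q ^+ 2 * X) = q ^+ 2 * X + q * (q ^+ 2 * X) by ring.
  by rewrite AE /M => h1 h2; lra.
- move=> i; have [[FN _] [HN _]] := (FB i, HB i); move: (FH i).
  (* Elements of the ball already agree up to order [N], so only the orders
     [N + t] matter. *)
  set D := F i - H i => FHs; pose t := (s - N)%N.
  have {}FHs : ordge (N + t) D.
    rewrite /t; have [Ns|sN] := leqP N s; first by rewrite subnKC.
    by rewrite (eqP (ltnW sN : s - N == 0)%N) addn0; exact: ordgeB.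
  apply: ordgeW (leNM s) _; rewrite -/t.
  have DZB : DZ (F i) - DZ (H i) = DZ D.
    by rewrite -clinB //; exact: div_sum_clin.
  have DYB j : DY (F i) j - DY (H i) j = DY D j.
    by rewrite /DY -clinB //; exact: div_sum_clin.
  have RB : ordge (N + t).+1
      (taylor_rem (DY (F i)) f - taylor_rem (DY (H i)) f).
    apply: (taylor_rem_sub_ord (leR t)) fo.
    + exact: DY_ord1 FN.
    + exact: DY_ord1 HN.
    + by move=> j; rewrite DYB; exact: DYe.
  have JB : ordge (o + (e + t).+1) (jac (DY (F i)) f - jac (DY (H i)) f).
    rewrite jacB (_ : (fun j => _) = DY D); last exact/funext.
    by apply: (jac_ord _ _ fo) => // j; exact: DYe.
  rewrite /T.
  set JF := jac (DY (F i)) f in JB *; set JH := jac (DY (H i)) f in JB *.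
  set RF := taylor_rem (DY (F i)) f in RB *.
  set RH := taylor_rem (DY (H i)) f in RB *.
  have -> : G - RF - DZ (F i) * (JF + RF) - (G - RH - DZ (H i) * (JH + RH)) =
    - (RF - RH) - DZ D * (JF + RF) - DZ (H i) * ((JF - JH) + (RF - RH)).
    by rewrite -DZB; ring.
  apply: ordgeB; first apply: ordgeB; first exact: ordgeN.
    exact: ordgeMW (leJ t) (DZe t _ FHs) (JR_ord _ FN).
  apply: ordgeMW (leJ' t) (DZ_ord1 _ HN) _.
  by apply: ordgeD => //; apply: ordgeW RB.
have [FN FM] := FB tt; exists (DZ (F tt)), (DY (F tt)); split.
- split; first exact: DZ_ord1.
  by apply/convergentE; exists r => //; exists q; exact: DZ_norm.
- split; first exact: DY_ord1.
  move=> i; apply/convergentE; exists r => //.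
  by exists (q * r); exact: DY_norm.
- have -> : subst (fun i => x i + DY (F tt) i) f =
      taylor_rem (DY (F tt)) f + f + jac (DY (F tt)) f.
    by rewrite /taylor_rem; ring.
  move: (FE tt) (DP _ FN); rewrite /T.
  set Z := DZ _; set J := jac _ f; set Rm := taylor_rem _ f => TE PE.
  have -> : (1 + Z) * (Rm + f + J) =
    f + (Z * f + J) + Rm + Z * (J + Rm) by ring.
  by rewrite PE -TE; ring.
- by move=> z0; exact: div_sum0.
Qed.

End Solve.
End Solving.

(** * Ideals and orders *)

Section Ideals.
Variable A : comNzRingType.

Lemma ideal_span_ind (S : set A) (P : A -> Prop) :
  P 0 -> (forall x y, P x -> P y -> P (x + y)) ->
  (forall a s, S s -> P (a * s)) -> forall x, ideal_span S x -> P x.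
Proof.
move=> P0 PD PS x [s [sS ->]]; elim: s sS => [|p s IH] sS.
  by rewrite big_nil.
rewrite big_cons; apply: PD; first by apply/PS/sS; rewrite inE eqxx.
by apply: IH => q qs; apply: sS; rewrite inE qs orbT.
Qed.

Lemma ideal_span_sum (S : set A) (I : finType) (F G : I -> A) :
  (forall i, S (G i)) -> ideal_span S (\sum_i F i * G i).
Proof.
move=> SG; exists [seq (F i, G i) | i : I]; split.
  by move=> p /mapP[i _ ->]; exact: SG.
by rewrite big_image.
Qed.

End Ideals.

Section Algebra.
Variables (R : realType) (K : fieldType) (v : realValuation R K) (n : nat).
Local Notation A := (cpseries v n).
Implicit Types (f g h : A) (a b c : mexp n).
Local Notation x := (fps_var K (n := n)).
Local Notation m := (maxideal v n).

Lemma cps_inj f g : f = g :> fpseries K n -> f = g.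
Proof. exact: val_inj. Qed.

Lemma cps_valM f g : (f * g : A) = cps_val f * cps_val g :> fpseries K n.
Proof. by []. Qed.

Lemma cps_valD f g : (f + g : A) = cps_val f + cps_val g :> fpseries K n.
Proof. by []. Qed.

Lemma cps_valB f g : (f - g : A) = cps_val f - cps_val g :> fpseries K n.
Proof. by []. Qed.

Lemma cps_val0 : (0 : A) = 0 :> fpseries K n.
Proof. by []. Qed.

Lemma cps_val1 : (1 : A) = 1 :> fpseries K n.
Proof. by []. Qed.

Lemma cps_valZ (k : K) f : (k *: f : A) = k *: cps_val f :> fpseries K n.
Proof. by []. Qed.

Lemma cps_val_sum (I : Type) (r : seq I) (P : pred I) (F : I -> A) :
  (\sum_(i <- r | P i) F i : A) = \sum_(i <- r | P i) cps_val (F i)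
    :> fpseries K n.
Proof. exact: (big_morph (@cps_val R K v n) cps_valD cps_val0). Qed.

Lemma cps_of_convergent (f : fpseries K n) : convergent v f ->
  exists g : A, g = f :> fpseries K n.
Proof.
by move=> fc; exists (CPSeries (asboolT fc : f \in fps_conv v (n := n))).
Qed.

Lemma cps_family_of_convergent (I : Type) (F : I -> fpseries K n) :
  (forall i, convergent v (F i)) ->
  exists G : I -> A, forall i, G i = F i :> fpseries K n.
Proof.
move=> Fc; have [G GF] := choice (fun i => cps_of_convergent (Fc i)).
by exists G.
Qed.

(** Each monomial of [f] is attributed to one chosen variable that divides it,
    so that the quotients converge on the same polydisc as [f]. *)
Lemma ordge_split s f : ordge s.+1 f ->
  exists F : 'I_n -> A, (forall i, ordge s (F i)) /\
    f = \sum_i cps_var v i * F i.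
Proof.
move=> fs.
pose F i : fpseries K n := fun a =>
  if [pick j | (0 < (a + mexp1 i)%R j)%N] == Some i
  then cps_val f (a + mexp1 i) else 0.
have Fc i : convergent v (F i).
  have /convergentE[r r_gt0 [M fM]] := cps_convergent f.
  apply/convergentE; exists r => //; exists (r^-1 * M) => t ut.
  have ut' : uniq [seq a + mexp1 i | a <- t].
    by rewrite map_inj_uniq // => a b; rewrite [a + _]addrC [b + _]addrC;
      exact: mexp_addI.
  rewrite ler_pdivlMl //; apply: le_trans (fM _ ut'); rewrite big_map mulr_sumr.
  apply: ler_sum => a _; rewrite mdegD mdeg_mexp1 addn1 exprS mulrCA /F.
  rewrite ler_wpM2r // ?mulr_ge0 ?exprn_ge0 ?(ltW r_gt0) //.
  by case: ifP => // _; rewrite rval0 rval_ge0.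
have [G GF] := cps_family_of_convergent Fc; exists G; split=> [i|].
  rewrite GF => a sa; rewrite /F; case: ifP => // _.
  by rewrite fs // mdegD mdeg_mexp1 addn1.
apply: cps_inj; rewrite cps_val_sum; apply/funext => a; rewrite fps_sumE.
have XE i : cps_val (cps_var v i * G i) a =
    if [pick j | (0 < a j)%N] == Some i then cps_val f a else 0.
  rewrite cps_valM GF -[cps_val _](@mono1E K n).
  have [[c ->]|nc] := pselect (exists c, a = mexp1 i + c).
    by rewrite mono_mulD /F addrC.
  rewrite mono_mul_out => [|c ac]; last by apply: nc; exists c.
  case: pickP => // j aj; case: eqP => // -[ji]; case: nc.
  exists [ffun k => (a k - (k == i))%N].
  apply/ffunP => k; rewrite mexpDE !ffunE.
  by case: eqP => [->|]; rewrite ?subnKC // -?ji // subn0.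
rewrite (eq_bigr _ (fun i _ => XE i)); case: pickP => [j aj|a0].
  rewrite (bigD1 j) //= eqxx big1 ?addr0 // => i /negbTE ij.
  by case: eqP => // -[ji]; rewrite ji eqxx in ij.
rewrite big1 //; apply: fs; rewrite /mdeg big1 // => i _.
by apply/eqP; rewrite -leqn0 leqNgt a0.
Qed.

Lemma maxidealP f : m f <-> ordge 1 f.
Proof.
split=> [|/ordge_split[F [_ ->]]].
  apply: (ideal_span_ind (P := fun f : A => ordge 1 f)) => [|p q|a _ [i _ <-]].
  - exact: ordge_zero.
  - exact: ordgeD.
  - exact: (ordgeM (@ordge0 K n a) (@ordge1_var K n i)).
rewrite (eq_bigr _ (fun i _ => mulrC _ _)).
by apply: ideal_span_sum => i; exists i.
Qed.

Lemma ideal_expP s f : ideal_exp m s f <-> ordge s f.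
Proof.
elim: s f => [|s IH] f; first by split=> // _; exact: ordge0.
split=> [|/ordge_split[F [Fs ->]]].
  apply: (ideal_span_ind (P := fun f : A => ordge s.+1 f)) =>
    [|p q|a _ [y /maxidealP y1 [z /IH zs <-]]].
  - exact: ordge_zero.
  - exact: ordgeD.
  - exact: (ordgeM (@ordge0 K n a) (ordgeM y1 zs)).
rewrite (eq_bigr (fun i => 1 * (cps_var v i * F i))) => [|i _]; last first.
  by rewrite mul1r.
apply: ideal_span_sum => i; exists (cps_var v i).
  exact/maxidealP/ordge1_var.
by exists (F i) => //; apply/IH.
Qed.

Lemma ord_unique f l : ordge l f -> ~ ordge l.+1 f -> ord f = l.
Proof.
move=> lf nlf; have lmax l' : ideal_exp m l' f -> (l' <= l)%N.
  move=> /ideal_expP l'f; rewrite leqNgt; apply/negP => ll'.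
  by apply: nlf; exact: ordgeW l'f.
rewrite /ord; case: xgetP => [_ ->|/(_ l)].
  case=> /ideal_expP of_ omax; apply/eqP; rewrite eqn_leq omax ?andbT.
    by apply: lmax; apply/ideal_expP.
  by apply/ideal_expP.
by case; split=> //; apply/ideal_expP.
Qed.

Lemma ordP f : f != 0 -> ordge (ord f) f /\ ~ ordge (ord f).+1 f.
Proof.
move=> f0; suff [l [lf nlf]] : exists l, ordge l f /\ ~ ordge l.+1 f.
  by rewrite (ord_unique lf nlf).
apply: contrapT => nl; case/eqP: f0; apply/cps_inj/ordge_eq0 => s.
elim: s => [|s IH]; first exact: ordge0.
by apply: contrapT => ns; apply: nl; exists s.
Qed.

Lemma jacD (y w : 'I_n -> fpseries K n) (f : fpseries K n) :
  jac (fun i => y i + w i) f = jac y f + jac w f.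
Proof. by rewrite /jac -big_split; apply: eq_bigr => i _; rewrite mulrDr. Qed.

Lemma jac_mull (g : fpseries K n) (y : 'I_n -> fpseries K n) f :
  jac (fun i => g * y i) f = g * jac y f.
Proof. by rewrite /jac mulr_sumr; apply: eq_bigr => i _; rewrite mulrCA. Qed.

(** [jac_comb s h f] is membership of [h] in the ideal
    $\mathfrak m^s \cdot j(f)$, with the coefficients made explicit. *)
Definition jac_comb (s : nat) (h f : A) : Prop :=
  exists y : 'I_n -> A, (forall i, ordge s (y i)) /\
    h = jac (fun i => y i) f :> fpseries K n.

Lemma jac_comb0 s f : jac_comb s 0 f.
Proof.
exists (fun=> 0); split=> [i|]; first exact: ordge_zero.
by rewrite /jac big1 // => i _; rewrite cps_val0 mulr0.
Qed.

Lemma jac_combD s h g f : jac_comb s h f -> jac_comb s g f ->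
  jac_comb s (h + g) f.
Proof.
move=> [y [ys hE]] [w [ws gE]]; exists (fun i => y i + w i).
by split=> [i|]; [exact: (ordgeD (ys i) (ws i))|rewrite cps_valD hE gE -jacD].
Qed.

Lemma jac_combM s t (a h f : A) : ordge s a -> jac_comb t h f ->
  jac_comb (s + t) (a * h) f.
Proof.
move=> as_ [y [yt hE]]; exists (fun i => a * y i).
by split=> [i|]; [exact: (ordgeM as_ (yt i))|rewrite cps_valM hE -jac_mull].
Qed.

Lemma jacobian_comb s h f : ideal_mul (ideal_exp m s) (jacobian f) h ->
  jac_comb s h f.
Proof.
apply: (ideal_span_ind (P := fun h => jac_comb s h f)) =>
    [|p q|a _ [b /ideal_expP bs [w wj <-]]].
- exact: jac_comb0.
- exact: jac_combD.
- apply: (@jac_combM 0 s) => //; rewrite -[s]addn0; apply: jac_combM bs _.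
  move: wj.
  apply: (ideal_span_ind (P := fun h => jac_comb 0 h f)) => [|p q|c _ [i _ <-]].
  + exact: jac_comb0.
  + exact: jac_combD.
  + exists (fun j => if j == i then c else 0); split=> //.
    rewrite /jac (bigD1 i) //= eqxx big1 ?addr0 => [|j /negbTE ->].
      by rewrite mulrC.
    by rewrite cps_val0 mulr0.
Qed.

Lemma principal_comb h f : ideal_mul m (ideal_span [set f]) h ->
  exists2 z : A, ordge 1 z & h = z * f.
Proof.
apply: (ideal_span_ind (P := fun h => exists2 z : A, ordge 1 z & h = z * f)) =>
    [|p q [z z1 ->] [w w1 ->]|a _ [b /maxidealP b1 [w wf <-]]].
- by exists 0; rewrite ?mul0r //; exact: ordge_zero.
- by exists (z + w); [exact: (ordgeD z1 w1)|rewrite mulrDl].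
- have [c ->] : exists c : A, w = c * f.
    move: wf.
    apply: (ideal_span_ind (P := fun h => exists c : A, h = c * f)) =>
      [|p q [c ->] [d ->]|c _ ->].
    + by exists 0; rewrite mul0r.
    + by exists (c + d); rewrite mulrDl.
    + by exists c.
  exists (a * (b * c)); last by rewrite !mulrA.
  apply: (ordgeM (@ordge0 K n a)).
  by rewrite -[1%N]addn0; exact: (ordgeM b1 (@ordge0 K n c)).
Qed.

(** * Automorphisms *)

Lemma lrmorphism_of (phi : A -> A) :
  (forall (k : K) f g, phi (k *: f + g) = k *: phi f + phi g) ->
  phi 1 = 1 -> (forall f g, phi (f * g) = phi f * phi g) ->
  exists psi : {lrmorphism A -> A}, psi =1 phi.
Proof.
move=> phiL phi1 phiM.
pose hL := GRing.isLinear.Build K A A *:%R phi phiL.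
pose hM := GRing.isMonoidMorphism.Build A A phi (phi1, phiM).
pose psi : {lrmorphism A -> A} := HB.pack phi hL hM.
by exists psi.
Qed.

Definition vals (u : 'I_n -> A) : 'I_n -> fpseries K n := fun i => u i.

Lemma subst_lrmorphism (u : 'I_n -> A) : (forall i, ordge 1 (u i)) ->
  exists phi : {lrmorphism A -> A},
    forall f, phi f = subst (vals u) f :> fpseries K n.
Proof.
move=> u1; have cu : clin (subst (vals u)) by exact: subst_clin.
have sc f : convergent v (subst (vals u) f).
  have [r0 [C [r0_gt0 C0 uO]]] :=
    bigO_family u1 (fun i => cps_convergent (u i)).
  have /convergentE[r1 r1_gt0 [M fM]] := cps_convergent f.
  pose r := Order.min r0 (r1 / (1 + C)).
  have C1 : 0 < 1 + C by rewrite ltr_wpDr.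
  have r_gt0 : 0 < r by rewrite lt_min r0_gt0 divr_gt0.
  have rr0 : r <= r0 by rewrite ge_min lexx.
  have rr1 : (1 + C) * r <= r1.
    by rewrite mulrC -ler_pdivlMr // ge_min lexx orbT.
  clearbody r; apply/convergentE; exists r => //; exists M.
  apply: (@subst_norm _ _ _ _ _ r1) fM => //; try exact: ltW.
  move=> i; apply: normleW (uO i r _); last by rewrite r_gt0.
  by rewrite expr1; apply: le_trans rr1; rewrite ler_wpM2r ?ltW // ltrDr.
have [phi phiE] := cps_family_of_convergent sc.
have [k f g||f g|psi psiE] := @lrmorphism_of phi; last first.
- by exists psi => f; rewrite psiE.
- by apply: cps_inj; rewrite phiE cps_valM substM // -!phiE.
- by apply: cps_inj; rewrite phiE cps_val1 subst1.
- apply: cps_inj; rewrite phiE cps_valD cps_valZ (cu.1 k) -!phiE.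
  by rewrite cps_valD cps_valZ.
Qed.

Lemma subst_cancel (u w : 'I_n -> fpseries K n) :
  (forall i, ordge 1 (u i)) -> (forall i, ordge 1 (w i)) ->
  (forall i, subst u (w i) = x i) ->
  forall f : fpseries K n, subst u (subst w f) = f.
Proof.
move=> u1 w1 uw f; rewrite subst_comp //.
by rewrite (_ : (fun i => _) = x) ?subst_id //; exact/funext.
Qed.

Lemma subst_local_aut (u w : 'I_n -> A) :
  (forall i, ordge 1 (u i)) -> (forall i, ordge 1 (w i)) ->
  (forall i, subst (vals u) (w i) = x i) ->
  (forall i, subst (vals w) (u i) = x i) ->
  exists2 phi : {lrmorphism A -> A}, local_aut phi &
    forall f, phi f = subst (vals u) f :> fpseries K n.
Proof.
move=> u1 w1 uw wu; have [phi phiE] := subst_lrmorphism u1.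
have [psi psiE] := subst_lrmorphism w1.
exists phi => //; split.
  by exists psi => f; apply: cps_inj;
    rewrite ?psiE ?phiE ?psiE ?phiE subst_cancel.
move=> _ [f /maxidealP f1 <-]; apply/maxidealP; rewrite phiE.
exact: subst_ord.
Qed.

(** The substitution inverse to $x + y$ on one side again has such an inverse,
    so that it is two-sided: a left and a right inverse coincide. *)
Lemma tangent_local_aut (y : 'I_n -> A) : (forall i, ordge 2 (vals y i)) ->
  exists2 phi : {lrmorphism A -> A}, local_aut phi &
    forall f, phi f = subst (fun i => x i + vals y i) f :> fpseries K n.
Proof.
move=> y2; have yc i : convergent v (vals y i) by exact: cps_convergent.
have [w [w2 wc wy]] := tangent_inverse y2 yc.
have [w' [w'2 _ w'w]] := tangent_inverse w2 wc.
have y1 := ordge1_shift y2; have w1 := ordge1_shift w2.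
have w'1 := ordge1_shift w'2.
have wyK := subst_cancel w1 y1 wy; have w'wK := subst_cancel w'1 w1 w'w.
have ywE (f : fpseries K n) :
    subst (fun i => x i + vals y i) f = subst (fun j => x j + w' j) f.
  by rewrite -[LHS]w'wK wyK.
have [W WE] := cps_family_of_convergent wc.
have yE : vals (fun i => cps_var v i + y i) = (fun i => x i + vals y i) by [].
have wE : vals (fun i => cps_var v i + W i) = (fun i => x i + w i).
  by apply/funext => i; rewrite /vals cps_valD WE.
have [||i|i|phi phiA phiE] := @subst_local_aut (fun i => cps_var v i + y i)
    (fun i => cps_var v i + W i).
- exact: y1.
- by move=> i; rewrite cps_valD WE; exact: w1.
- by rewrite yE ywE cps_valD WE; exact: w'w.
- by rewrite wE; exact: wy.
by exists phi.
Qed.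

Lemma local_aut_comp (phi psi : {lrmorphism A -> A}) :
  local_aut phi -> local_aut psi ->
  exists2 chi : {lrmorphism A -> A}, local_aut chi & chi =1 phi \o psi.
Proof.
move=> [phiB phim] [psiB psim].
have [k f g||f g|chi chiE] := @lrmorphism_of (phi \o psi).
- by rewrite /= !linearP.
- by rewrite /= !rmorph1.
- by rewrite /= !rmorphM.
exists chi => //; split; first exact: (eq_bij (bij_comp phiB psiB)).
by move=> _ [f fm <-]; rewrite chiE /=; apply: phim; exists (psi f) => //;
  apply: psim; exists f.
Qed.

(** The inverse of a local automorphism is local because a local automorphism
    preserves constant terms. *)
Lemma local_aut_inv (phi : {lrmorphism A -> A}) : local_aut phi ->
  exists2 psi : {lrmorphism A -> A}, local_aut psi &
    cancel phi psi /\ cancel psi phi.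
Proof.
move=> [[psi phiK psiK] phim]; have phiI := can_inj phiK.
have [k f g||f g|chi chiE] := @lrmorphism_of psi.
- by apply: phiI; rewrite psiK linearP /= !psiK.
- by apply: phiI; rewrite rmorph1 psiK.
- by apply: phiI; rewrite psiK rmorphM /= !psiK.
exists chi; last by split=> f; rewrite chiE.
split.
  by exists phi => f; rewrite chiE.
move=> _ [f /maxidealP f1 <-]; apply/maxidealP; rewrite chiE.
set g := psi f; pose c := cps_val g 0; pose h := g - c *: 1.
have h1 : ordge 1 h.
  move=> a; rewrite ltnS leqn0 => /eqP/mdeg_eq0 ->.
  rewrite cps_valB fps_subE cps_valZ fps_scaleE cps_val1 -(@mono0 K n) /mono.
  by rewrite eqxx mulr1 subrr.
have ph1 : ordge 1 (phi h).
  by apply/maxidealP; apply: phim; exists h => //; exact/maxidealP.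
have c0 : c = 0.
  have : phi g = phi h + c *: 1.
    by rewrite /h linearB /= linearZ /= rmorph1 subrK.
  rewrite psiK => /(congr1 (fun p : A => cps_val p 0)).
  rewrite cps_valD fps_addE ph1 ?mdeg0 // f1 ?mdeg0 //.
  rewrite cps_valZ fps_scaleE cps_val1 -(@mono0 K n) /mono eqxx mulr1 add0r.
  by move=> <-.
by move=> a; rewrite ltnS leqn0 => /eqP/mdeg_eq0 ->.
Qed.

End Algebra.

(** * Determinacy *)

Section Determinacy.
Variables (R : realType) (K : fieldType) (v : realValuation R K) (n : nat).
Local Notation A := (cpseries v n).
Implicit Types (f g h : A) (a b c : mexp n).
Local Notation x := (fps_var K (n := n)).
Local Notation m := (maxideal v n).

Lemma cps_mono a : exists h, h = mono K a :> fpseries K n.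
Proof. exact: cps_of_convergent (convergent_mono v a). Qed.

Lemma mexp_of_deg (i : 'I_n) l : exists a, mdeg a = l.
Proof.
elim: l => [|l [a al]]; first by exists 0; rewrite mdeg0.
by exists (a + mexp1 i); rewrite mdegD mdeg_mexp1 al addn1.
Qed.

(** The flag [right] distinguishes membership of [h] in
    $\mathfrak m^{e + 2} j(f)$, for right equivalence, from membership in
    $\mathfrak m^{e + 1} f + \mathfrak m^{e + 2} j(f)$, for contact
    equivalence. *)
Definition tangent_comb (e : nat) (right : bool) (h f : A) : Prop :=
  exists (z : A) (y : 'I_n -> A),
  [/\ ordge e.+1 z, forall i, ordge e.+2 (y i),
      h = cps_val z * cps_val f + jac (vals y) f :> fpseries K n &
      right -> z = 0].

Lemma tangent_combM e e' right g h f : ordge e g -> tangent_comb e' right h f ->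
  tangent_comb (e + e') right (g * h) f.
Proof.
move=> ge [z [y [z1 y2 hE z0]]].
exists (g * z), (fun i => g * y i); split.
- by rewrite -addnS; exact: (ordgeM ge z1).
- by move=> i; rewrite -!addnS; exact: (ordgeM ge (y2 i)).
- by rewrite !cps_valM hE mulrDr mulrA -jac_mull.
- by move=> /z0 ->; rewrite mulr0.
Qed.

Section Core.
Variables (k : nat) (right : bool) (f : A).
Hypotheses (f_neq0 : f != 0) (f1 : ordge 1 f).
Hypothesis comb : forall h, ordge (k + 2) h -> tangent_comb 0 right h f.

(** A monomial of degree $k + 2$ lies in an ideal of elements of order at least
    $\mathrm{ord}(f) + 1$. *)
Lemma ord_le : (ord f <= k.+1)%N.
Proof.
have [fo nfo] := ordP f_neq0.
have [i _] : exists i : 'I_n, True.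
  apply: contrapT => ni; apply: nfo => a _; apply: f1.
  by rewrite /mdeg big1 // => i; case: ni; exists i.
have [a ak] := mexp_of_deg i (k + 2); have [h hE] := cps_mono a.
have [|z [y [z1 y2 hzy _]]] := comb (h := h).
  by rewrite hE -ak; exact: ordge_mono.
have : ordge (ord f).+1 h.
  rewrite hzy; apply: ordgeD; first exact: (ordgeM z1 fo).
  by apply: (jac_ord _ y2 fo); rewrite addn1.
move=> /(_ a); rewrite hE /mono eqxx ak => h0.
rewrite leqNgt; apply/negP => ko; have {}ko : (k + 2 < (ord f).+1)%N.
  by rewrite addn2.
by have /eqP := h0 ko; rewrite oner_eq0.
Qed.

(** The solved equation reads $(1 + U) \varphi(f) = g$; applying
    $\varphi^{-1}$ gives [f] as a unit times $\varphi^{-1}(g)$. *)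
Lemma perturbation_equiv g : ordge (2 * k + 2 - ord f).+1 (f - g) ->
  exists2 phi : {lrmorphism A -> A}, local_aut phi &
  exists2 u : A, u \is a GRing.unit & f = u * phi g /\ (right -> u = 1).
Proof.
have ole := ord_le; pose e := (k.+1 - ord f)%N.
set N := (2 * k + 2 - ord f).+1 => fg.
have oeN : N = (ord f + e.*2.+1)%N by rewrite /N /e; lia.
have ekN : N = (e + (k + 2))%N by rewrite /N /e; lia.
have [fo _] := ordP f_neq0.
(* A monomial of degree [N = e + (k + 2)] is one of degree [e] times one to
   which the hypothesis applies. *)
have combd (d : {ffun 'I_n -> 'I_N.+1}) : exists p : A * ('I_n -> A),
    [/\ ordge e.+1 p.1, forall i, ordge e.+2 (p.2 i),
      mdeg (inbox d) = N ->
        mono K (inbox d) = cps_val p.1 * cps_val f + jac (vals p.2) f &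
      right -> p.1 = 0].
  have [dN|dN] := eqVneq (mdeg (inbox d)) N; last first.
    exists (0, fun=> 0); split=> //= /eqP.
    by rewrite (negbTE dN).
  have [|b [c [dE be]]] := @mexp_split n e (inbox d).
    by rewrite dN ekN leq_addr.
  have [hb hbE] := cps_mono b; have [hc hcE] := cps_mono c.
  have hbe : ordge e hb by rewrite hbE -be; exact: ordge_mono.
  have [|z [y [z1 y2 hzy z0]]] := tangent_combM hbe (comb (h := hc) _).
    rewrite hcE; suff -> : (k + 2)%N = mdeg c by exact: ordge_mono.
    by apply: (@addnI e); rewrite -ekN -dN dE mdegD be.
  rewrite addn0 in z1 y2; exists (z, y); split=> //= _.
  by rewrite dE -monoM -hbE -hcE -hzy.
have [zy zyP] := choice combd.
have gf : ordge N (cps_val g - cps_val f).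
  by rewrite -opprB; exact: ordgeN.
have gfc : convergent v (cps_val g - cps_val f).
  exact: (cps_convergent (g - f)).
have [d|d|d i|d i|d|Z [Y [[Z1 Zc] [Y2 Yc] ZY Z0]]] :=
  @perturbed_equation_solvable R K v n f (cps_val g - cps_val f) (ord f) e N oeN
    fo gf
    (cps_convergent f) gfc (fun d => cps_val (zy d).1) (fun d => vals (zy d).2).
- by case: (zyP d).
- exact: cps_convergent.
- by case: (zyP d) => _ y2 _ _; exact: y2.
- exact: cps_convergent.
- by case: (zyP d).
have [U UE] := cps_of_convergent Zc; have [y yE] := cps_family_of_convergent Yc.
have [W Wc WU] := unit_inverse (ordgeW (ltn0Sn e : (1 <= e.+1)%N) Z1) Zc.
have [w wE] := cps_of_convergent Wc.
have wU : w * (1 + U) = 1.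
  by apply: cps_inj; rewrite cps_valM cps_valD cps_val1 wE UE.
have y2 i : ordge 2 (vals y i) by rewrite /vals yE; exact: (ordgeW _ (Y2 i)).
have [phi phiA phiE] := tangent_local_aut y2.
have [psi psiA [phiK psiK]] := local_aut_inv phiA.
have gE : (1 + U) * phi f = g.
  apply: cps_inj; rewrite cps_valM cps_valD cps_val1 phiE UE.
  rewrite (_ : (fun i => x i + vals y i) = (fun i => x i + Y i)); last first.
    by apply/funext => i; rewrite /vals yE.
  by rewrite ZY addrC subrK.
exists psi => //; exists (psi w).
  by apply/rmorph_unit/unitrPr; exists (1 + U).
split.
  rewrite -gE -[LHS]phiK -(rmorphM psi). congr (psi _).
  by rewrite mulrA wU mul1r.
move=> bT; suff U0 : U = 0.
  by move: wU; rewrite U0 addr0 mulr1 => ->; rewrite rmorph1.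
apply: cps_inj; rewrite UE; apply: Z0 => d.
by case: (zyP d) => _ _ _ /(_ bT) ->.
Qed.

End Core.

(** * Series of order one *)

Lemma mdeg1P a : mdeg a = 1%N -> exists i, a = mexp1 i.
Proof.
elim/mexp_ind: a => [|a i _]; first by rewrite mdeg0.
rewrite mdegD mdeg_mexp1 addn1 => -[/mdeg_eq0 ->].
by exists i; rewrite add0r.
Qed.

(** The linear map [l] sends the coordinate [i0] to the linear part of [f] and
    exchanges the others so as to leave out the coordinate [i], where that
    linear part has a nonzero coefficient; its inverse [w] solves for that
    coordinate. *)
Lemma regular_coordinate (f : A) (i0 i : 'I_n) : ordge 1 f ->
  cps_val f (mexp1 i) != 0 ->
  exists2 phi : {lrmorphism A -> A}, local_aut phi & phi (cps_var v i0) = f.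
Proof.
move=> f1; set c := fun k => cps_val f (mexp1 k); rewrite -/(c i) => ci0.
pose tau := tperm i0 i.
have tau_i j : (tau j == i0) = (j == i).
  by rewrite -(inj_eq (@perm_inj _ tau)) tpermK tpermL.
have tau_i0 j : (tau j == i) = (j == i0).
  by rewrite -(inj_eq (@perm_inj _ tau)) tpermK tpermR.
pose l j : A :=
  if j == i0 then \sum_k c k *: cps_var v k else cps_var v (tau j).
pose w j : A := if j == i
  then (c i)^-1 *: (cps_var v i0 - \sum_(k | k != i) c k *: cps_var v (tau k))
  else cps_var v (tau j).
have var1 j : ordge 1 (cps_var v j) by exact: ordge1_var.
have l1 j : ordge 1 (l j).
  rewrite /l; case: ifP => // _; rewrite cps_val_sum; apply: ordge_sum => k _.
  by rewrite cps_valZ; exact/ordgeZ/var1.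
have w1 j : ordge 1 (w j).
  rewrite /w; case: ifP => // _; rewrite cps_valZ cps_valB cps_val_sum.
  apply/ordgeZ/ordgeB => //; apply: ordge_sum => k _.
  by rewrite cps_valZ; exact/ordgeZ/var1.
have [L LE] := subst_lrmorphism l1; have [W WE] := subst_lrmorphism w1.
have Lx j : L (cps_var v j) = l j.
  by apply: cps_inj; rewrite LE subst_var.
have Wx j : W (cps_var v j) = w j.
  by apply: cps_inj; rewrite WE subst_var.
have Lw j : L (w j) = cps_var v j.
  rewrite /w; case: eqP => [->|/eqP ji]; last first.
    by rewrite Lx /l tau_i (negbTE ji) tpermK.
  rewrite linearZ linearB /= Lx {1}/l eqxx linear_sum /= (bigD1 i) //=.
  rewrite [X in _ *: (_ + _ - X)](eq_bigr (fun k => c k *: cps_var v k)).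
    by rewrite addrK scalerA mulVf // scale1r.
  by move=> k ki; rewrite linearZ /= Lx /l tau_i (negbTE ki) tpermK.
have Wl j : W (l j) = cps_var v j.
  rewrite /l; case: eqP => [->|/eqP ji]; last first.
    by rewrite Wx /w tau_i0 (negbTE ji) tpermK.
  rewrite linear_sum /= (bigD1 i) //= linearZ /= Wx {1}/w eqxx.
  rewrite scalerA divff // scale1r.
  rewrite [X in _ + X](eq_bigr (fun k => c k *: cps_var v (tau k))).
    by rewrite subrK.
  by move=> k ki; rewrite linearZ /= Wx /w (negbTE ki).
have [||j|j|Phi PhiA PhiE] := subst_local_aut (u := l) (w := w) => //.
  by rewrite -LE Lw.
  by rewrite -WE Wl.
have PhiL p : Phi p = L p by apply: cps_inj; rewrite PhiE LE.
(* In the coordinates straightened by the linear part, [f] is tangent to the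
   coordinate [i0]. *)
pose y j : A := if j == i0 then W f - cps_var v i0 else 0.
have y2 j : ordge 2 (vals y j).
  rewrite /vals /y; case: eqP => [_|_]; last exact: ordge_zero.
  have -> : W f - cps_var v i0 = W (f - l i0) by rewrite linearB /= Wl.
  rewrite WE; apply: subst_ord => // a.
  rewrite ltnS leq_eqVlt => /orP[/eqP a1|].
    have [k ->] := mdeg1P a1.
    rewrite cps_valB fps_subE /l eqxx cps_val_sum fps_sumE (bigD1 k) //=.
    rewrite fps_scaleE {1}/fps_var eqxx mulr1.
    rewrite big1 ?addr0 ?subrr // => j' jk; rewrite fps_scaleE /fps_var.
    case: eqP => [/ffunP/(_ k)|]; last by rewrite mulr0.
    by rewrite !ffunE eqxx [k == j']eq_sym (negbTE jk).
  by move=> a0; exact: (ordgeB f1 (l1 i0)).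
have [Psi PsiA PsiE] := tangent_local_aut y2.
have [Chi ChiA ChiE] := local_aut_comp PhiA PsiA.
exists Chi => //; rewrite ChiE /=.
have -> : Psi (cps_var v i0) = W f.
  apply: cps_inj; rewrite PsiE subst_var ?/vals ?/y ?eqxx; last first.
    exact: ordge1_shift y2.
  by rewrite cps_valB addrC subrK.
rewrite PhiL; apply: cps_inj; rewrite LE WE subst_cancel // => j.
by rewrite -LE Lw.
Qed.

End Determinacy.

Theorem theorem1p10 (R : realType) (K : fieldType) (v : realValuation R K)
    (n k : nat) (f : cpseries v n) :
  (f != 0 -> ideal_exp (maxideal v n) 2 f ->
     (ideal_exp (maxideal v n) (k + 2)%N `<=`
        ideal_mul (ideal_exp (maxideal v n) 2) (jacobian f) ->
      right_determined (2 * k + 2 - ord f)%N f) /\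
     (ideal_exp (maxideal v n) (k + 2)%N `<=`
        ideal_add (ideal_mul (maxideal v n) (ideal_span [set f]))
                  (ideal_mul (ideal_exp (maxideal v n) 2) (jacobian f)) ->
      contact_determined (2 * k + 2 - ord f)%N f)) /\
  (f != 0 -> maxideal v n f -> ~ ideal_exp (maxideal v n) 2 f ->
     [/\ ord f = 1%N, right_determined 1 f &
         exists2 i : 'I_n, i = 0%N :> nat & right_equiv f (cps_var v i)]).
Proof.
split=> [f0 /ideal_expP f2|f0 /maxidealP f1 nf2].
  have f1 : ordge 1 f by exact: ordgeW f2.
  split=> [inc g /ideal_expP fg|inc g /ideal_expP fg].
    have comb (h : cpseries v n) : ordge (k + 2) h -> tangent_comb 0 true h f.
      move=> /ideal_expP/inc/jacobian_comb[y [y2 hE]].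
      exists 0, y; split=> //.
      by rewrite cps_val0 mul0r add0r.
    have [phi phiA [u _ [fE u1]]] := perturbation_equiv f0 f1 comb fg.
    by exists phi => //; rewrite fE u1 // mul1r.
  have comb (h : cpseries v n) : ordge (k + 2) h -> tangent_comb 0 false h f.
    move=> /ideal_expP/inc[p /principal_comb[z z1 ->]].
    move=> [q /jacobian_comb[y [y2 qE]] <-].
    by exists z, y; split=> //; rewrite cps_valD qE cps_valM.
  have [phi phiA [u uU [fE _]]] := perturbation_equiv f0 f1 comb fg.
  by exists phi => //; exists u.
have {}nf2 : ~ ordge 2 f by move=> /ideal_expP.
have lin (g : cpseries v n) : ordge 2 (f - g) -> exists i,
    cps_val g (mexp1 i) != 0.
  move=> fg; apply: contrapT => ng; apply: nf2 => a a2.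
  have [a1|a1] := ltnP (mdeg a) 1; first exact: f1.
  have [i ->] : exists i, a = mexp1 i by apply: mdeg1P; lia.
  have : cps_val (f - g) (mexp1 i) = 0 by apply: fg; rewrite mdeg_mexp1.
  rewrite cps_valB fps_subE => /eqP; rewrite subr_eq0 => /eqP ->.
  by apply/eqP/negPn/negP => gi; apply: ng; exists i.
have coord (g : cpseries v n) (i0 : 'I_n) : ordge 2 (f - g) ->
    exists2 phi : {lrmorphism cpseries v n -> cpseries v n}, local_aut phi &
      phi (cps_var v i0) = g.
  move=> fg; have [i gi] := lin g fg; apply: regular_coordinate gi.
  have -> : g = f - (f - g) by rewrite opprB addrC subrK.
  by apply: ordgeB => //; exact: ordgeW fg.
have ff : ordge 2 (f - f) by rewrite subrr; exact: ordge_zero.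
have [i _] := lin f ff.
pose i0 : 'I_n := Ordinal (leq_ltn_trans (leq0n i) (ltn_ord i)).
have [phi phiA phif] := coord f i0 ff.
split; first exact: ord_unique.
  move=> g /ideal_expP fg; have [psi psiA psig] := coord g i0 fg.
  have [psi' psi'A [psiK _]] := local_aut_inv psiA.
  have [chi chiA chiE] := local_aut_comp phiA psi'A.
  by exists chi => //; rewrite chiE /= -psig psiK phif.
by exists i0 => //; exists phi.
Qed.
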